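(* Fix $\sigma^2>0$. Let all spectral laws be compactly supported probability laws on $[0,\infty)$ with positive mean, and let $L_\mu$ be the spectrum-stage map of the context. (i) For every spectral law $\mu$, the map $\omega\mapsto L_\mu(\omega)$ is nondecreasing. (ii) For two spectral laws $\mu_1,\mu_2$: $\mu_2\succeq_{\rm St}\mu_1$ if and only if $L_{\mu_2}(\omega)\ge L_{\mu_1}(\omega)$ for every $\omega>0$. (iii) Consequently, $\mu_2\succeq_{\rm cx}\mu_1$ implies $L_{\mu_2}(\omega)\ge L_{\mu_1}(\omega)$ for every $\omega>0$. (iv) Fix a prior $\pi$ on $\mathbb R$ with finite second moment and the noise level $\sigma^2$, let $B^\star\sim\pi$, and for each spectral law $\mu$ initialize the Bayes-VAMP recursion $\tau_{t+1}=T_{\mu,\pi}(\tau_t)$ at $\tau^B_{0,+}(\mu)=L_\mu(\operatorname{Var}(B^\star))$. If $\mu_2\succeq_{\rm St}\mu_1$, then $\tau_B^+(\mu_2)\ge\tau_B^+(\mu_1)$ and $m_\pi(\tau_B^+(\mu_2))\ge m_\pi(\tau_B^+(\mu_1))$.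
   Context: For a spectral law $\mu$ and $S\sim\mu$: for $\omega>0$, $L_\mu(\omega)=\mathbb E_\mu\big[\frac{\sigma^2\omega}{\sigma^2+\omega S}\big]\big/\mathbb E_\mu\big[\frac{\omega S}{\sigma^2+\omega S}\big]$, and $L_\mu(0)=\sigma^2/\mathbb E_\mu[S]$. Stieltjes transform: $G_\mu(c)=\mathbb E_\mu[1/(S+c)]$, $c>0$. Stieltjes order: $\mu_2\succeq_{\rm St}\mu_1$ means $G_{\mu_2}(c)\ge G_{\mu_1}(c)$ for every $c>0$. Convex order: $\mu_2\succeq_{\rm cx}\mu_1$ means $\mathbb E_{\mu_2}[\varphi(S)]\ge\mathbb E_{\mu_1}[\varphi(S)]$ for every integrable convex $\varphi:[0,\infty)\to\mathbb R$. With $B^\star\sim\pi$, $Z\sim N(0,1)$ independent, for $\tau>0$: $m_\pi(\tau)=\mathbb E[(\mathbb E[B^\star\mid B^\star+\sqrt\tau Z]-B^\star)^2]$, $\mathcal E_\pi(\tau)=\dfrac{m_\pi(\tau)}{1-m_\pi(\tau)/\tau}$, $T_{\mu,\pi}(\tau)=L_\mu(\mathcal E_\pi(\tau))$, and $\tau_B^+(\mu)=\max\{\tau>0:T_{\mu,\pi}(\tau)=\tau\}$ is the greatest fixed point. *)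

(* Defs.v *)
From HB Require Import structures.
From mathcomp Require Import all_boot all_order all_algebra.
From mathcomp Require Import all_classical all_reals all_analysis.
Import Order.TTheory GRing.Theory Num.Theory.
Import numFieldNormedType.Exports.

Set Implicit Arguments.
Unset Strict Implicit.
Unset Printing Implicit Defensive.

Local Open Scope classical_set_scope.
Local Open Scope ring_scope.

Definition expect d (T : measurableType d) (R : realType)
  (P : probability T R) (X : T -> R) : R := fine 'E_P[X]%E.

Section conditional_expectation.
Context d (T : measurableType d) (R : realType).
Variables (P : probability T R) (X Y : T -> R).

(* g is a version of E[X | sigma(Y)] *)
Definition is_cond_expectation (g : T -> R) : Prop :=
  [/\ measurable_fun [set: g_sigma_algebra_preimageType Y] g,
      P.-integrable [set: T] (EFin \o g) &
      forall A, g_sigma_algebra_preimage Y A ->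
        (\int[P]_(w in A) (g w)%:E = \int[P]_(w in A) (X w)%:E)%E].

(* The default value cst 0 is only taken when no version exists, which cannot
   happen when X is P-integrable and Y is measurable. *)
Definition cond_expectation : T -> R := xget (cst 0) is_cond_expectation.

End conditional_expectation.

Section spectral_laws.
Context {R : realType}.
Implicit Types mu : probability (measurableTypeR R) R.

Definition spectral_law mu : Prop :=
  (exists K : set R, [/\ compact K, K `<=` `[0, +oo[ & mu K = 1%E]) /\
  (0 < 'E_mu[fun s => s])%E.

(* Only the values at omega >= 0 are meaningful. *)
Definition spectrum_map (sigma2 : R) mu (omega : R) : R :=
  if omega == 0 then sigma2 / expect mu (fun s => s)
  else expect mu (fun s => sigma2 * omega / (sigma2 + omega * s)) /
       expect mu (fun s => omega * s / (sigma2 + omega * s)).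

Definition stieltjes mu (c : R) : R := expect mu (fun s => (s + c)^-1).

(* stieltjes_ge mu2 mu1 is mu2 >=_St mu1, and similarly for convex_ge. *)
Definition stieltjes_ge mu2 mu1 : Prop :=
  forall c : R, 0 < c -> stieltjes mu1 c <= stieltjes mu2 c.

(* A function [0, +oo) -> R is represented by a function R -> R of which only
   the values on [0, +oo) are used. *)
Definition convex_ge mu2 mu1 : Prop :=
  forall phi : R -> R,
    convex_function (E := R^o) `[0, +oo[ phi ->
    mu1.-integrable `[0, +oo[ (EFin \o phi) ->
    mu2.-integrable `[0, +oo[ (EFin \o phi) ->
    (\int[mu1]_(s in `[0%R, +oo[) (phi s)%:E <=
     \int[mu2]_(s in `[0%R, +oo[) (phi s)%:E)%E.

End spectral_laws.

Section bayes_vamp.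
Context {R : realType}.
Implicit Types (mu pi : probability (measurableTypeR R) R).

(* The independent pair (B, Z) with B ~ pi and Z ~ N(0, 1) is realized by the
   two coordinates of R * R under the product law. *)
Definition mmse pi (tau : R) : R :=
  let P := (pi \x normal_prob (0 : R) 1)%E in
  let B := fun w : R * R => w.1 in
  let Y := fun w : R * R => w.1 + Num.sqrt tau * w.2 in
  expect P (fun w => (cond_expectation P B Y w - B w) ^+ 2).

Definition extrinsic_variance pi (tau : R) : R :=
  mmse pi tau / (1 - mmse pi tau / tau).

Definition vamp_map (sigma2 : R) mu pi (tau : R) : R :=
  spectrum_map sigma2 mu (extrinsic_variance pi tau).

Definition bayes_vamp_run (sigma2 : R) mu pi (tau : nat -> R) : Prop :=
  tau 0%N = spectrum_map sigma2 mu (fine 'V_pi[fun b => b]%E) /\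
  forall t, tau t.+1 = vamp_map sigma2 mu pi (tau t).

Definition is_greatest_fixed_point (sigma2 : R) mu pi (tau : R) : Prop :=
  let F := [set t : R | 0 < t /\ vamp_map sigma2 mu pi t = t] in
  F tau /\ ubound F tau.

End bayes_vamp.

(* Main.v *)
(* With [c = sigma2 / omega], [L_mu omega = sigma2 / (1 / G_mu c - c)]: this is
   an increasing function of [G_mu c] for fixed [c], hence (ii); and (iii) is
   the convexity of [1 / (s + c)]. In terms of [A = E (sigma2 + omega S)^-1] and
   [D = E (S / (sigma2 + omega S))], [L_mu = sigma2 A / D] for all
   [omega >= 0], and its monotonicity (i) is Chebyshev's sum inequality.

   For (iv), given [B + sqrt tau Z = y] the posterior mean is the quotient of two
   Gaussian averages and minimizes the quadratic risk for every [y]. Since the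
   observation at a larger [tau] is a Gaussian smoothing of the one at a smaller
   [tau], the mmse is nondecreasing; comparison with the linear estimators gives
   [mmse tau <= v tau / (v + tau)], [v = E B^2], so that the extrinsic variance
   lies in [0, v]. The greatest fixed point is then the supremum of the
   [tau > 0] with [tau <= T tau], a set that grows with [L_mu]. *)

Require Import Defs.
From mathcomp Require Import all_boot all_order all_algebra.
From mathcomp Require Import all_classical all_reals all_analysis.
From mathcomp Require Import measurable_realfun ring lra.
Import Order.TTheory GRing.Theory Num.Theory.
Import numFieldNormedType.Exports.
Local Open Scope classical_set_scope.
Local Open Scope ring_scope.

(** * Fixed points *)

Section greatest_fixed_point.
Context {R : realType}.
Implicit Types (L m : R -> R) (kappa v s t : R).

(** Kept abstract in [m], so that the fixed-point argument involves no probability;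
    [extrinsic (mmse pi)] unfolds to [extrinsic_variance pi]. *)
Definition extrinsic m t := m t / (1 - m t / t).

Definition pre_fixed_points L m := [set t : R | 0 < t /\ t <= L (extrinsic m t)].

Lemma extrinsicE m t : 0 < t -> m t < t -> extrinsic m t = m t * t / (t - m t).
Proof.
move=> t0 mt; rewrite /extrinsic.
by field; rewrite !gt_eqF//= subr_gt0.
Qed.

(** The inverse of [extrinsic m t] is [1 / m t - 1 / t]. The last hypothesis is
    [1 / m t >= 1 / v + 1 / t] cleared of denominators, so that it also makes sense for [v = 0] or
    [m t = 0]. *)
Lemma extrinsic_itv m v t : 0 < t -> 0 <= m t -> 0 <= v ->
  (v + t) * m t <= v * t -> 0 <= extrinsic m t <= v.
Proof.
move=> t0 m0 v0 mv.
have mt : m t < t by nra.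
rewrite extrinsicE// divr_ge0 ?mulr_ge0 ?subr_ge0 ?(ltW mt) ?(ltW t0)//=.
by rewrite ler_pdivrMr ?subr_gt0//; nra.
Qed.

(** [L 0] lies in the set because [extrinsic m] is nonnegative, and [L v] bounds the set because
    [extrinsic m] is at most [v]. *)
Lemma has_sup_pre_fixed_points L m v : 0 <= v ->
  0 < L 0 -> (forall x y, 0 <= x -> x <= y -> L x <= L y) ->
  (forall t, 0 < t -> 0 <= m t) ->
  (forall t, 0 < t -> (v + t) * m t <= v * t) ->
  has_sup (pre_fixed_points L m).
Proof.
move=> v0 L0 Lnd m0 mv; split.
  exists (L 0); split => //.
  have /andP[e0 _] := extrinsic_itv m v _ L0 (m0 _ L0) v0 (mv _ L0).
  exact: Lnd.
exists (L v) => t [t0 /le_trans]; apply; apply: Lnd.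
  by have /andP[] := extrinsic_itv m v _ t0 (m0 _ t0) v0 (mv _ t0).
by have /andP[] := extrinsic_itv m v _ t0 (m0 _ t0) v0 (mv _ t0).
Qed.

(* Tarski's argument: jumps of [m] are upward, so the relative Lipschitz bound
   on [L] is all the continuity that is needed. *)
Lemma sup_pre_fixed_points L m kappa v : 0 <= kappa -> 0 <= v ->
  0 < L 0 -> (forall x y, 0 <= x -> x <= y -> L x <= L y) ->
  (forall x e, 0 <= x -> 0 <= e -> L (x + e) <= L x * (1 + kappa * e)) ->
  (forall t, 0 < t -> 0 <= m t) ->
  (forall t u, 0 < t -> t <= u -> m t <= m u) ->
  (forall t, 0 < t -> (v + t) * m t <= v * t) ->
  let s := sup (pre_fixed_points L m) in
  0 < s /\ L (extrinsic m s) = s.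
Proof.
move=> k0 v0 L0 Lnd Llip m0 mnd mv s.
have hs := has_sup_pre_fixed_points L m v v0 L0 Lnd m0 mv.
have e0 t : 0 < t -> 0 <= extrinsic m t.
  by move=> t0; have /andP[] := extrinsic_itv m v _ t0 (m0 _ t0) v0 (mv _ t0).
have mt t : 0 < t -> m t < t by move=> t0; have := m0 _ t0; have := mv _ t0; nra.
have s0 : 0 < s.
  apply: (lt_le_trans L0); apply: ub_le_sup; first by case: hs.
  by split => //; exact: Lnd _ (e0 _ L0).
split=> //.
(* [f] is the extrinsic variance with [m] frozen at its value at [s]. Beyond [k] it is
   nonincreasing, it is continuous at [s], and since [m] is nondecreasing it lies above
   [extrinsic m] to the left of [s] and below it to the right. *)
set k := m s; pose f (t : R) := k * t / (t - k).
have ks : k < s by exact: mt.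
have k_ge0 : 0 <= k by exact: m0.
have es : extrinsic m s = f s by rewrite extrinsicE.
have f0 t : k < t -> 0 <= f t.
  by move=> kt; rewrite divr_ge0 ?mulr_ge0 ?subr_ge0//; lra.
have cf : {for s, continuous f}.
  apply: cvgM; first by apply: cvgMr; exact: cvg_id.
  apply: cvgV; first by rewrite subr_eq0 gt_eqF.
  by apply: cvgB; [exact: cvg_id|exact: cvg_cst].
have ef t : 0 < t -> k < t -> (t <= s -> extrinsic m t <= f t) /\
    (s <= t -> f t <= extrinsic m t).
  move=> t0 kt; split => st; rewrite extrinsicE ?mt//.
    have mk : m t <= k by exact: mnd.
    rewrite ler_pdivlMr ?subr_gt0// mulrAC ler_pdivrMr ?subr_gt0 ?mt//.
    have := m0 _ t0; nra.
  have mk : k <= m t by exact: mnd.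
  rewrite ler_pdivlMr ?subr_gt0 ?mt// /f mulrAC ler_pdivrMr ?subr_gt0//.
  nra.
have Lf t : k < t -> 
  (t <= s -> L (f t) <= L (f s) * (1 + kappa * (f t - f s))) /\
  (s <= t -> L (f s) <= L (f t) * (1 + kappa * (f s - f t))).
  have key x y : k < x -> x <= y -> f y <= f x.
    move=> kx xy; rewrite ler_pdivrMr ?subr_gt0 ?(lt_le_trans kx)//.
    rewrite mulrAC ler_pdivlMr ?subr_gt0//; nra.
  move=> kt; split => ts.
    have := Llip (f s) (f t - f s) (f0 _ ks).
    by rewrite subr_ge0 addrC subrK; apply; exact: key.
  have := Llip (f t) (f s - f t) (f0 _ kt).
  by rewrite subr_ge0 addrC subrK; apply; exact: key.
rewrite es; apply/eqP; rewrite eq_le; apply/andP; split.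
- rewrite leNgt; apply/negP => sL.
  (* If [s < L (f s)], a point [t] slightly above [s] is not a pre-fixed point, so [L (f t) <= t];
     the growth bound then gives [L (f s) <= g t], against the continuity of [g] at [s], where
     [g s = s]. *)
  pose g (t : R) := t * (1 + kappa * (f s - f t)).
  have cg : {for s, continuous g}.
    apply: cvgM; first exact: cvg_id.
    apply: cvgD; first exact: cvg_cst.
    by apply: cvgMr; apply: cvgB; [exact: cvg_cst|exact: cf].
  have gs : g s = s by rewrite /g subrr mulr0 addr0 mulr1.
  have : \forall t \near s, g t < L (f s).
    by apply: (cvgr_lt (g s) cg); rewrite gs.
  move=> /nbhs_ballP[e /= e_gt0 He].
  have := He (s + e / 2); rewrite -ball_normE/= opprD addrA subrr add0r normrN.
  rewrite gtr0_norm ?divr_gt0// => /(_ _)/wrap[]; first lra.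
  set t := s + e / 2 => gt.
  have st : s < t by rewrite /t; lra.
  have kt : k < t by lra.
  have t0 : 0 < t by lra.
  have Lt : L (extrinsic m t) < t.
    rewrite ltNge; apply/negP => tL.
    have : t <= s by apply: ub_le_sup; [by case: hs|].
    by rewrite leNgt st.
  have h1 := (ef t t0 kt).2 (ltW st).
  have h2 := (Lf t kt).2 (ltW st).
  have h3 : L (f t) <= t by apply: le_trans (ltW Lt); exact: Lnd (f0 _ kt) h1.
  move: gt; rewrite ltNge => /negP; apply.
  apply: (le_trans h2); rewrite /g ler_wpM2r//.
  rewrite leNgt; apply/negP => neg.
  have Ls : 0 < L (f s) by lra.
  have Lt0 : 0 <= L (f t) by apply: (le_trans (ltW L0)); exact: Lnd (f0 _ kt).
  by move: (lt_le_trans Ls h2); rewrite ltNge mulr_ge0_le0// ltW.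
- rewrite leNgt; apply/negP => sL.
  (* If [L (f s) < s], a pre-fixed point [t] close to [s] satisfies [t <= L (f t)]; the growth bound
     then gives [0 <= g t], against the continuity of [g] at [s], where [g s < 0]. *)
  pose g (t : R) := L (f s) * (1 + kappa * (f t - f s)) - t.
  have cg : {for s, continuous g}.
    apply: cvgB; last exact: cvg_id.
    apply: cvgMr; apply: cvgD; first exact: cvg_cst.
    by apply: cvgMr; apply: cvgB; [exact: cf|exact: cvg_cst].
  have gs : g s = L (f s) - s by rewrite /g subrr mulr0 addr0 mulr1.
  have : \forall t \near s, g t < 0.
    by apply: (cvgr_lt (g s) cg); rewrite gs subr_lt0.
  move=> /nbhs_ballP[e /= e_gt0 He].
  (* The second term of the minimum keeps [t] above [k], where the comparisons with [f] hold. *)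
  pose d := Num.min e (s - k).
  have d0 : 0 < d by rewrite lt_min e_gt0 subr_gt0.
  have [t [t0 tL] st] := sup_adherent d0 hs.
  have ts : t <= s by apply: ub_le_sup; [by case: hs|].
  have kt : k < t.
    apply: le_lt_trans st; rewrite -/s lerBrDr -lerBrDl.
    by rewrite /d ge_min lexx orbT.
  have : g t < 0.
    apply: He; rewrite -ball_normE/= ger0_norm ?subr_ge0// ltrBlDr.
    have : s - d < t by [].
    have : d <= e by rewrite /d ge_min lexx.
    lra.
  rewrite subr_lt0 ltNge => /negP; apply; apply: (le_trans tL).
  apply: le_trans ((Lf t kt).1 ts).
  exact: Lnd (e0 _ t0) ((ef t t0 kt).1 ts).
Qed.

End greatest_fixed_point.

(** * Spectral laws *)

(* The square makes the real power [_ `^ -1] applicable to negative values. *)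
Lemma measurable_funV d (T : measurableType d) (R : realType) (D : set T)
    (f : T -> R) :
  measurable_fun D f -> measurable_fun D (fun x => (f x)^-1).
Proof.
move=> mf; rewrite (_ : (fun x => _) = fun x => f x * (f x ^+ 2) `^ (-1)).
  apply: measurable_funM => //.
  apply: (measurableT_comp (measurable_powR (- 1))).
  exact: measurable_funX.
apply/funext => x; rewrite powR_inv1 ?sqr_ge0//.
have [->|fx0] := eqVneq (f x) 0; first by rewrite mul0r invr0.
by rewrite expr2 invfM mulrA divff// mul1r.
Qed.

(** * Integrals of functions bounded on a set of full measure *)

Section bounded_prob.
Context {d} {T : measurableType d} {R : realType} (P : probability T R).
Variables (A : set T) (f : T -> R) (M : R).
Hypothesis mA : measurable A.
Hypothesis mf : measurable_fun setT f.
Hypothesis fM : forall x, A x -> `|f x| <= M.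

Lemma integrable_bounded_prob : P.-integrable A (EFin \o f).
Proof.
apply: measurable_bounded_integrable => //.
- by rewrite (le_lt_trans (probability_le1 _ _))// ltry.
- exact: measurable_funTS.
exists M; split; first exact: num_real.
by move=> x Mx s As; apply: le_trans (fM s As) (ltW Mx).
Qed.

(** Expectations integrate over the whole space, where [f] may be unbounded. The complement of [A]
    is negligible; it is first removed from the integral of the absolute value, which yields
    integrability, and then from the integral itself. *)
Lemma integral_bounded_conull : P A = 1%E ->
  (\int[P]_x (f x)%:E = \int[P]_(x in A) (f x)%:E)%E.
Proof.
move=> PA; have mAC : measurable (~` A) by exact: measurableC.
have PAC : P (~` A) = 0%E by rewrite probability_setC// PA subee.
have if_ : P.-integrable setT (EFin \o f).
  apply/integrableP; split; first exact/measurable_EFinP.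
  rewrite (@ge0_negligible_integral _ _ _ _ _ (~` A))//; last first.
    by apply/measurableT_comp => //; exact/measurable_EFinP.
  by rewrite setTD setCK; case/integrableP: integrable_bounded_prob.
by rewrite (@negligible_integral _ _ _ _ _ (~` A))// setTD setCK.
Qed.

End bounded_prob.

(** * The spectrum map of one law carried by a bounded interval *)

Section spectrum_map.
Context {R : realType}.
Variable (mu : probability (measurableTypeR R) R).
Variables (K : set (measurableTypeR R)) (k sigma2 : R).
Hypothesis k_ge0 : 0 <= k.
Hypothesis mK : measurable K.
Hypothesis muK : mu K = 1%E.
Hypothesis Kk : forall s, K s -> 0 <= s <= k.
Hypothesis mean_gt0 : (0 < 'E_mu[fun s => s])%E.
Hypothesis sigma2_gt0 : 0 < sigma2.

Local Notation E f := (\int[mu]_(s in K) f s).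

Let int (f : R -> R) M : measurable_fun setT f ->
  (forall s, K s -> `|f s| <= M) -> mu.-integrable K (EFin \o f).
Proof. by move=> mf fM; exact: (integrable_bounded_prob mu K f M mK mf fM). Qed.

Let expectE (f : R -> R) M :
  measurable_fun setT f -> (forall s, K s -> `|f s| <= M) -> expect mu f = E f.
Proof.
by move=> mf fM; rewrite /expect unlock /Rintegral (integral_bounded_conull mu K f M mK mf fM muK).
Qed.

Let E1 : E (fun=> 1) = 1.
Proof.
have h : fine (mu K) = 1 by rewrite muK.
by rewrite Rintegral_cst// mul1r; exact: h.
Qed.

Let mid : measurable_fun setT (fun s : R => s).
Proof. exact: measurable_id. Qed.

Let normK s : K s -> `|s| <= k.
Proof. by move=> /Kk/andP[s0 sk]; rewrite ger0_norm. Qed.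

Let mean : R := E (fun s : R => s).

Let mean_gt0' : 0 < mean.
Proof.
move: mean_gt0; rewrite unlock (integral_bounded_conull mu K _ k mK mid normK muK) => m0.
rewrite fine_gt0// m0/= ltey_eq; apply/orP; left.
by apply: integrable_fin_num => //; exact: (int _ k).
Qed.

Let den (w s : R) : 0 <= w -> K s -> 0 < sigma2 <= sigma2 + w * s.
Proof.
by move=> w0 /Kk/andP[s0 _]; rewrite sigma2_gt0 lerDl mulr_ge0.
Qed.

Definition resolvent (w s : R) := (sigma2 + w * s)^-1.

Let mres (w : R) : measurable_fun setT (resolvent w).
Proof.
by apply: measurable_funV; apply: measurable_funD => //; apply: measurable_funM.
Qed.

Let res_gt0 (w s : R) : 0 <= w -> K s -> 0 < resolvent w s.
Proof. by move=> w0 Ks; rewrite invr_gt0; have := den w s w0 Ks; lra. Qed.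

Let res_le (w s : R) : 0 <= w -> K s -> resolvent w s <= sigma2^-1.
Proof.
by move=> w0 Ks; have /andP[? ?] := den w s w0 Ks; rewrite lef_pV2// posrE; lra.
Qed.

Let res_ge (w s : R) : 0 <= w -> K s -> (sigma2 + w * k)^-1 <= resolvent w s.
Proof.
move=> w0 Ks; have /andP[s1 s2] := den w s w0 Ks.
have wsk : w * s <= w * k by rewrite ler_wpM2l//; case/andP: (Kk s Ks).
by rewrite lef_pV2 ?posrE; lra.
Qed.

Let normres (w s : R) : 0 <= w -> K s -> `|resolvent w s| <= sigma2^-1.
Proof. by move=> w0 Ks; rewrite ger0_norm ?(ltW (res_gt0 _ _ w0 Ks))//; exact: res_le. Qed.

Let normsres (w s : R) : 0 <= w -> K s -> `|s * resolvent w s| <= k * sigma2^-1.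
Proof. by move=> w0 Ks; rewrite normrM ler_pM ?normK ?normres. Qed.

Let msres (w : R) : measurable_fun setT (fun s : R => s * resolvent w s).
Proof. exact: measurable_funM. Qed.

Let int1 : mu.-integrable K (EFin \o (fun=> 1)).
Proof. by apply: (int _ 1) => // s _; rewrite normr1. Qed.

Let intid : mu.-integrable K (EFin \o (fun s : R => s)).
Proof. exact: (int _ k). Qed.

Let intres (w : R) : 0 <= w -> mu.-integrable K (EFin \o resolvent w).
Proof. by move=> w0; apply: (int _ sigma2^-1) => // s; exact: normres. Qed.

Let intsres (w : R) : 0 <= w -> mu.-integrable K (EFin \o (fun s : R => s * resolvent w s)).
Proof. by move=> w0; apply: (int _ (k * sigma2^-1)) => // s; exact: normsres. Qed.

Let intZ (f : R -> R) r : mu.-integrable K (EFin \o f) ->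
  mu.-integrable K (EFin \o (fun s : R => r * f s)).
Proof. by move=> fi; exact: (integrableZl mK r fi). Qed.

(** [shrinkage] and [signal] are the means [A] and [D] with [L_mu = sigma2 A / D]. The factor
    [omega] common to both means of [spectrum_map] is left out, so that the quotient is also
    meaningful at 0. They are taken over [K], where the integrands are bounded. *)
Definition shrinkage (w : R) := E (resolvent w).
Definition signal (w : R) := E (fun s : R => s * resolvent w s).

(** The combined integrand is identically 1 on [K]. Through [signalE] this makes [L_mu] a function
    of [shrinkage] alone. *)
Lemma shrinkage_signal (w : R) : 0 <= w -> sigma2 * shrinkage w + w * signal w = 1.
Proof.
move=> w0; rewrite /shrinkage /signal -RintegralZl ?intres//.
rewrite -RintegralZl ?intsres// -RintegralD ?intZ ?intres ?intsres//.
rewrite -[RHS]E1; apply: eq_Rintegral => s /set_mem Ks.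
have /andP[? ?] := den w s w0 Ks.
by rewrite /resolvent; field; rewrite gt_eqF//; lra.
Qed.

Lemma shrinkage_gt0 (w : R) : 0 <= w -> 0 < shrinkage w.
Proof.
move=> w0; have wk : 0 < sigma2 + w * k by rewrite ltr_pwDl ?mulr_ge0.
apply: (@lt_le_trans _ _ (sigma2 + w * k)^-1); first by rewrite invr_gt0.
rewrite -[leLHS]mulr1 -E1 -RintegralZl//; apply: le_Rintegral => //.
- exact: intZ.
- exact: intres.
by move=> s Ks; rewrite mulr1 res_ge.
Qed.

(** On [K] the resolvent is at least the constant [(sigma2 + w * k)^-1]; strictness then comes from
    the positive mean of the law. *)
Lemma signal_gt0 (w : R) : 0 <= w -> 0 < signal w.
Proof.
move=> w0; have wk : 0 < sigma2 + w * k by rewrite ltr_pwDl ?mulr_ge0.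
apply: (@lt_le_trans _ _ ((sigma2 + w * k)^-1 * mean)).
  by rewrite mulr_gt0// invr_gt0.
rewrite -RintegralZl//; apply: le_Rintegral => //.
- exact: intZ.
- exact: intsres.
move=> s Ks; rewrite mulrC ler_wpM2l ?res_ge//.
by case/andP: (Kk s Ks).
Qed.

(** For positive [w] the factor [w] cancels; at 0 the quotient reduces to [sigma2 / mean], the value
    set apart in the definition. *)
Lemma spectrum_mapE (w : R) : 0 <= w ->
  spectrum_map sigma2 mu w = sigma2 * shrinkage w / signal w.
Proof.
rewrite le_eqVlt eq_sym => /predU1P[->|w0].
  have -> : shrinkage 0 = sigma2^-1.
    rewrite -[RHS]mulr1 -E1 -RintegralZl//.
    by apply: eq_Rintegral => s _; rewrite /resolvent mul0r addr0 mulr1.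
  have -> : signal 0 = mean / sigma2.
    rewrite -RintegralZr//; apply: eq_Rintegral => s _.
    by rewrite /resolvent mul0r addr0.
  rewrite /spectrum_map eqxx (expectE _ k)// -/mean.
  by field; rewrite !gt_eqF.
have w0' := ltW w0; rewrite /spectrum_map gt_eqF//.
have -> : (fun s : R => sigma2 * w / (sigma2 + w * s)) =
    (fun s : R => (sigma2 * w) * resolvent w s) by [].
have -> : (fun s : R => w * s / (sigma2 + w * s)) =
    (fun s : R => w * (s * resolvent w s)) by apply/funext => s; rewrite mulrA.
rewrite (expectE _ (sigma2 * w * sigma2^-1)); last 2 first.
- exact: measurable_funM.
- move=> s Ks; rewrite normrM gtr0_norm ?mulr_gt0// ler_wpM2l ?normres//.
  by rewrite ltW ?mulr_gt0.
rewrite (expectE _ (w * (k * sigma2^-1))); last 2 first.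
- exact: measurable_funM.
- by move=> s Ks; rewrite normrM gtr0_norm// ler_wpM2l ?normsres.
rewrite (RintegralZl _ mK (intres _ w0')) (RintegralZl _ mK (intsres _ w0')).
rewrite -/(shrinkage w) -/(signal w).
by field; rewrite !gt_eqF ?signal_gt0.
Qed.

(** For [w = sigma2 / c] one has [sigma2 + w s = w (s + c)]. *)
Lemma stieltjesE (c : R) : 0 < c ->
  stieltjes mu c = sigma2 / c * shrinkage (sigma2 / c).
Proof.
move=> c0; have w0 : 0 < sigma2 / c by rewrite divr_gt0.
have cK (s : R) : K s -> c <= s + c.
  by move=> /Kk/andP[s0 _]; rewrite lerDr.
rewrite /stieltjes (expectE _ c^-1).
- rewrite -RintegralZl ?intres ?ltW//; apply: eq_Rintegral => s /set_mem Ks.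
  have := cK s Ks; have := den _ s (ltW w0) Ks; rewrite /resolvent => h1 h2.
  have sc0 : 0 < s + c by exact: lt_le_trans h2.
  have -> : sigma2 + sigma2 / c * s = sigma2 * (s + c) / c.
    by field; rewrite gt_eqF.
  by field; rewrite !gt_eqF.
- by apply: measurable_funV; exact: measurable_funD.
- move=> s /cK cs; have sc0 : 0 < s + c by exact: lt_le_trans cs.
  by rewrite gtr0_norm ?invr_gt0// lef_pV2.
Qed.

(* Chebyshev's sum inequality: [rho] is the mean of [s] under the weight
   [resolvent w2], and [(s - rho) (W s - W rho) >= 0] for the increasing ratio
   [W] of the two resolvents. *)
Lemma shrinkage_signal_le (w1 w2 : R) : 0 <= w1 -> w1 <= w2 ->
  shrinkage w1 * signal w2 <= shrinkage w2 * signal w1.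
Proof.
move=> w10 w12; have w20 : 0 <= w2 by exact: le_trans w12.
pose rho := signal w2 / shrinkage w2.
have A2 := shrinkage_gt0 w2 w20; have D2 := signal_gt0 w2 w20.
have rho0 : 0 < rho by rewrite divr_gt0.
have D2E : signal w2 = rho * shrinkage w2 by rewrite divfK ?gt_eqF.
(* The value at [s = rho] of the ratio [resolvent w1 s / resolvent w2 s]. *)
pose W := (sigma2 + w2 * rho) / (sigma2 + w1 * rho).
have intB w (r : R) : 0 <= w ->
    mu.-integrable K (EFin \o (fun s : R => s * resolvent w s - r * resolvent w s)).
  by move=> w0; apply: (integrableB mK (intsres _ w0) (intZ _ _ (intres _ w0))).
have EB w (r : R) : 0 <= w ->
    E (fun s : R => s * resolvent w s - r * resolvent w s) =
    signal w - r * shrinkage w.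
  by move=> w0; rewrite RintegralB ?RintegralZl ?intsres ?intZ ?intres.
(* The left-hand side vanishes by the choice of [rho], which leaves
   [rho * shrinkage w1 <= signal w1]. *)
suff : W * (signal w2 - rho * shrinkage w2) <= signal w1 - rho * shrinkage w1.
  rewrite D2E subrr mulr0 subr_ge0 => h.
  by have := ler_wpM2l (ltW A2) h; lra.
rewrite -!EB// -RintegralZl ?intB//; apply: le_Rintegral => //.
- by apply: intZ; exact: intB.
- exact: intB.
move=> s Ks; have /andP[_ d1] := den w1 s w10 Ks; have /andP[_ d2] := den w2 s w20 Ks.
have p1 : 0 < sigma2 + w1 * s by exact: lt_le_trans d1.
have p2 : 0 < sigma2 + w2 * s by exact: lt_le_trans d2.
have p3 : 0 < sigma2 + w1 * rho by rewrite ltr_pwDl// mulr_ge0// ltW.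
rewrite -subr_ge0 /W /resolvent.
rewrite [leRHS](_ : _ = (s - rho) ^+ 2 * sigma2 * (w2 - w1) /
  ((sigma2 + w1 * s) * (sigma2 + w2 * s) * (sigma2 + w1 * rho))); last first.
  by field; rewrite !gt_eqF.
move: (sqr_ge0 (s - rho)); move: (_ ^+ 2) => X X0.
by rewrite divr_ge0 ?mulr_ge0 ?subr_ge0 ?(ltW sigma2_gt0) ?(ltW p1)
  ?(ltW p2) ?(ltW p3).
Qed.

Lemma spectrum_map_gt0 (w : R) : 0 <= w -> 0 < spectrum_map sigma2 mu w.
Proof.
by move=> w0; rewrite spectrum_mapE// divr_gt0 ?mulr_gt0 ?shrinkage_gt0 ?signal_gt0.
Qed.

Lemma spectrum_map_nondecreasing (w1 w2 : R) : 0 <= w1 -> w1 <= w2 ->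
  spectrum_map sigma2 mu w1 <= spectrum_map sigma2 mu w2.
Proof.
move=> w10 w12; have w20 : 0 <= w2 by exact: le_trans w12.
rewrite !spectrum_mapE// ler_pdivrMr ?signal_gt0// mulrAC.
rewrite ler_pdivlMr ?signal_gt0// -!mulrA ler_wpM2l ?(ltW sigma2_gt0)//.
exact: shrinkage_signal_le.
Qed.

(** Adding [e] to the argument lowers [shrinkage] and divides [signal] by at most
    [1 + k / sigma2 * e], because the denominators [sigma2 + w s] grow at most by this factor on
    [K]. This relative bound supplies the continuity for the fixed point and for the passage to
    [w = 0]. *)
Lemma spectrum_map_growth (w e : R) : 0 <= w -> 0 <= e ->
  spectrum_map sigma2 mu (w + e) <=
  spectrum_map sigma2 mu w * (1 + k / sigma2 * e).
Proof.
move=> w0 e0; have we0 : 0 <= w + e by exact: addr_ge0.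
have le_A : shrinkage (w + e) <= shrinkage w.
  apply: le_Rintegral; rewrite ?intres// => s Ks.
  have /andP[s1 s2] := den w s w0 Ks; have /andP[s3 s4] := den _ s we0 Ks.
  have /andP[s0 _] := Kk s Ks.
  by rewrite lef_pV2 ?posrE ?lerD2l ?ler_wpM2r ?lerDl//; lra.
have le_D : signal w <= (1 + k / sigma2 * e) * signal (w + e).
  rewrite -RintegralZl ?intsres//; apply: le_Rintegral => //.
  - exact: intsres.
  - by apply: intZ; exact: intsres.
  move=> s Ks; have /andP[s1 s2] := den w s w0 Ks; have /andP[s3 s4] := den _ s we0 Ks.
  have /andP[s0 sk] := Kk s Ks.
  rewrite mulrCA ler_wpM2l// /resolvent ler_pdivlMr ?(lt_le_trans s3)//.
  rewrite ler_pdivrMl ?(lt_le_trans s1)//.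
  have h : 0 <= k / sigma2 * e by rewrite mulr_ge0// divr_ge0// ltW.
  have h2 : s * e <= sigma2 * (k / sigma2 * e).
    by rewrite mulrCA mulrA divfK ?gt_eqF// ler_wpM2r.
  have h3 : 0 <= w * s * (k / sigma2 * e) by apply: mulr_ge0 => //; exact: mulr_ge0.
  by move: (k / sigma2 * e) h2 h3 => x h2 h3; lra.
have A0 := shrinkage_gt0 w w0; have D0 := signal_gt0 w w0.
have De := signal_gt0 _ we0.
move: (1 + k / sigma2 * e) le_D => x le_D.
rewrite !spectrum_mapE// -!mulrA ler_wpM2l ?(ltW sigma2_gt0)//.
rewrite ler_pdivrMr// -!mulrA; apply: (le_trans le_A).
by rewrite ler_peMr ?(ltW A0)// ler_pdivlMl// mulr1.
Qed.

Lemma signalE (w : R) : 0 < w -> signal w = (1 - sigma2 * shrinkage w) / w.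
Proof.
move=> w0; rewrite -(shrinkage_signal w (ltW w0)) addrAC subrr add0r.
by rewrite mulrC mulKf ?gt_eqF.
Qed.

End spectrum_map.

(** * Comparison of spectral laws in the Stieltjes and convex orders *)

Section spectral_laws.
Context {R : realType}.
Implicit Types mu : probability (measurableTypeR R) R.

Lemma spectral_law_itv mu : spectral_law mu -> exists K (k : R),
  [/\ 0 <= k, measurable K, mu K = 1%E & forall s, K s -> 0 <= s <= k].
Proof.
move=> [[K [cK K0 muK]] _].
have [M [_ KM]] := compact_bounded cK.
(* Boundedness holds for every constant above [M], and [M] may be negative; this choice is above [M]
   and nonnegative. *)
exists K, (`|M| + 1); split => //.
  by apply: closed_measurable; apply: compact_closed.
move=> s Ks; have := K0 s Ks; rewrite /= in_itv/= andbT => s0; rewrite s0/=.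
have : `|s| <= `|M| + 1 by apply: KM => //; rewrite ltr_pwDr// ler_norm.
by rewrite ger0_norm.
Qed.

Lemma spectrum_map_monotone (sigma2 : R) mu : 0 < sigma2 -> spectral_law mu ->
  forall w1 w2 : R, 0 <= w1 -> w1 <= w2 ->
  spectrum_map sigma2 mu w1 <= spectrum_map sigma2 mu w2.
Proof.
move=> sigma2_gt0 smu w1 w2.
have [K [k [k0 mK muK Kk]]] := spectral_law_itv mu smu.
have mean_gt0 := smu.2; by apply: (spectrum_map_nondecreasing mu K k).
Qed.

(** With [A] the [shrinkage] at [w], [L_mu w = sigma2 w A / (1 - sigma2 A)] is increasing in [A],
    and the Stieltjes transform at [sigma2 / w] is [w A]. The Boolean equality serves both
    directions of (ii). *)
Lemma spectrum_map_le_stieltjes (sigma2 : R) mu1 mu2 (w : R) :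
  0 < sigma2 -> spectral_law mu1 -> spectral_law mu2 -> 0 < w ->
  (spectrum_map sigma2 mu1 w <= spectrum_map sigma2 mu2 w) =
  (stieltjes mu1 (sigma2 / w) <= stieltjes mu2 (sigma2 / w)).
Proof.
move=> sigma2_gt0 smu1 smu2 w0; have w0' := ltW w0.
have [K1 [k1 [k10 mK1 muK1 Kk1]]] := spectral_law_itv mu1 smu1.
have [K2 [k2 [k20 mK2 muK2 Kk2]]] := spectral_law_itv mu2 smu2.
have c0 : 0 < sigma2 / w by rewrite divr_gt0.
have wE : sigma2 / (sigma2 / w) = w by field; rewrite !gt_eqF.
have mean1 := smu1.2; have mean2 := smu2.2.
rewrite (stieltjesE mu1 K1 k1 sigma2)// (stieltjesE mu2 K2 k2 sigma2)//.
rewrite (spectrum_mapE mu1 K1 k1 sigma2)// (spectrum_mapE mu2 K2 k2 sigma2)//.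
rewrite wE ler_pM2l//.
have D1 : 0 < signal mu1 K1 sigma2 w by exact: (signal_gt0 mu1 K1 k1).
have D2 : 0 < signal mu2 K2 sigma2 w by exact: (signal_gt0 mu2 K2 k2).
rewrite ler_pdivrMr// mulrAC ler_pdivlMr// -!mulrA ler_pM2l//.
rewrite (signalE mu1 K1 k1)// (signalE mu2 K2 k2)//.
rewrite !mulrA ler_pM2r ?invr_gt0// !mulrBr !mulr1 mulrCA [in leRHS]mulrCA.
by rewrite [in leRHS](mulrC (shrinkage _ _ _ _)) lerD2r.
Qed.

Lemma stieltjes_ge_spectrum_map (sigma2 : R) mu1 mu2 :
  0 < sigma2 -> spectral_law mu1 -> spectral_law mu2 ->
  stieltjes_ge mu2 mu1 <-> forall w : R, 0 < w ->
    spectrum_map sigma2 mu1 w <= spectrum_map sigma2 mu2 w.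
Proof.
move=> sigma2_gt0 smu1 smu2; split => [G w w0|L c c0].
  by rewrite spectrum_map_le_stieltjes//; apply: G; rewrite divr_gt0.
have wE : sigma2 / (sigma2 / c) = c by field; rewrite !gt_eqF.
have w0 : 0 < sigma2 / c by rewrite divr_gt0.
by have := L _ w0; rewrite spectrum_map_le_stieltjes// wE.
Qed.

(** The convexity gap is an explicit fraction with numerator [u (1 - u) (x - y)^2] and positive
    denominator. *)
Lemma convex_function_inv (c : R) : 0 < c ->
  convex_function (E := R^o) `[0, +oo[ (fun s => (s + c)^-1).
Proof.
move=> c0 t x y; rewrite !inE/= !in_itv/= !andbT => x0 y0.
rewrite !convRE.
have -> : conv t x y = t%:num * x + (1 - t%:num) * y by [].
rewrite /unstable.onem.
have t0 : 0 <= t%:num by []. have t1 : t%:num <= 1 by [].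
move: (t%:num) t0 t1 => u u0 u1.
have X0 : 0 < x + c by rewrite ltr_wpDl.
have Y0 : 0 < y + c by rewrite ltr_wpDl.
have U0 : 0 < u * x + (1 - u) * y + c.
  by rewrite ltr_wpDl// addr_ge0 ?mulr_ge0 ?subr_ge0.
rewrite -subr_ge0 [leRHS](_ : _ = u * (1 - u) * (x - y) ^+ 2 /
  ((x + c) * (y + c) * (u * x + (1 - u) * y + c))); last first.
  by field; rewrite !gt_eqF.
move: (sqr_ge0 (x - y)); move: (_ ^+ 2) => Z Z0.
by rewrite divr_ge0 ?mulr_ge0 ?subr_ge0 ?(ltW X0) ?(ltW Y0) ?(ltW U0).
Qed.

Lemma spectral_law_nonneg mu : spectral_law mu -> mu `[0, +oo[%classic = 1%E.
Proof.
move=> smu; have [K [k [k0 mK muK Kk]]] := spectral_law_itv mu smu.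
apply/eqP; rewrite eq_le probability_le1//= -muK le_measure ?inE//.
by move=> s /Kk/andP[s0 _]; rewrite /= in_itv/= s0.
Qed.

Lemma convex_ge_stieltjes_ge mu1 mu2 : spectral_law mu1 -> spectral_law mu2 ->
  convex_ge mu2 mu1 -> stieltjes_ge mu2 mu1.
Proof.
move=> smu1 smu2 cx c c0.
pose phi (s : R) := (s + c)^-1.
have mphi : measurable_fun setT phi.
  by apply: measurable_funV; exact: measurable_funD.
have mI : measurable (`[0, +oo[%classic : set (measurableTypeR R)) by [].
have phic (s : R) : `[0, +oo[%classic s -> `|phi s| <= c^-1.
  rewrite /= in_itv/= andbT => s0; have sc0 : 0 < s + c by rewrite ltr_wpDl.
  by rewrite gtr0_norm ?invr_gt0// lef_pV2 ?posrE// lerDr.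
have i1 := integrable_bounded_prob mu1 _ phi c^-1 mI mphi phic.
have i2 := integrable_bounded_prob mu2 _ phi c^-1 mI mphi phic.
have := cx phi (convex_function_inv c c0) i1 i2.
rewrite /stieltjes /expect unlock.
rewrite (integral_bounded_conull mu1 _ phi c^-1 mI mphi phic (spectral_law_nonneg mu1 smu1)).
rewrite (integral_bounded_conull mu2 _ phi c^-1 mI mphi phic (spectral_law_nonneg mu2 smu2)).
by move=> ?; rewrite fine_le//; exact: integrable_fin_num.
Qed.

Lemma spectral_law_spectrum_map (sigma2 : R) mu : 0 < sigma2 -> spectral_law mu ->
  0 < spectrum_map sigma2 mu 0 /\ exists2 kappa : R, 0 <= kappa &
    forall w e : R, 0 <= w -> 0 <= e ->
    spectrum_map sigma2 mu (w + e) <= spectrum_map sigma2 mu w * (1 + kappa * e).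
Proof.
move=> sigma2_gt0 smu.
have [K [k [k0 mK muK Kk]]] := spectral_law_itv mu smu.
have mean_gt0 := smu.2; split; first by apply: (spectrum_map_gt0 mu K k).
exists (k / sigma2).
  by rewrite divr_ge0// ltW.
by move=> w e w0 e0; apply: (spectrum_map_growth mu K k).
Qed.

(** Part (ii) covers only positive arguments, while the extrinsic variance can vanish. At 0 the
    chain [L_1 0 <= L_1 d <= L_2 d <= L_2 0 * (1 + kappa * d)] is used with [d] small. *)
Lemma spectrum_map_le_of_stieltjes_ge (sigma2 : R) mu1 mu2 :
  0 < sigma2 -> spectral_law mu1 -> spectral_law mu2 -> stieltjes_ge mu2 mu1 ->
  forall w : R, 0 <= w ->
    spectrum_map sigma2 mu1 w <= spectrum_map sigma2 mu2 w.
Proof.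
move=> sigma2_gt0 smu1 smu2 G.
have L := (stieltjes_ge_spectrum_map sigma2 mu1 mu2 sigma2_gt0 smu1 smu2).1 G.
move=> w; rewrite le_eqVlt => /predU1P[<-|]; last exact: L.
have [L0 [kappa k0 gr]] := spectral_law_spectrum_map sigma2 mu2 sigma2_gt0 smu2.
apply/ler_addgt0Pr => e e0.
have k1 : 0 < kappa + 1 by rewrite ltr_wpDl.
(* Chosen so that [L_2 0 * (kappa + 1) * d = e]; the added 1 keeps the denominator positive when
   [kappa = 0]. *)
pose d := e / (spectrum_map sigma2 mu2 0 * (kappa + 1)).
have d0 : 0 < d by rewrite divr_gt0// mulr_gt0.
apply: (le_trans (spectrum_map_monotone sigma2 mu1 sigma2_gt0 smu1 0 d (lexx _) (ltW d0))).
apply: (le_trans (L d d0)).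
have := gr 0 d (lexx _) (ltW d0); rewrite add0r => /le_trans; apply.
have -> : e = spectrum_map sigma2 mu2 0 * ((kappa + 1) * d).
  by rewrite mulrA /d mulrC divfK// gt_eqF// mulr_gt0.
by rewrite mulrDr mulr1 lerD2l ler_pM2l// ler_wpM2r ?(ltW d0)// lerDl.
Qed.

End spectral_laws.

(** * Gaussian integrals *)

Section normal_integrals.
Context {R : realType}.
Local Notation leb := (@lebesgue_measure R).
Implicit Types (m s x y : R) (f : R -> \bar R).

Lemma measurable_affine m s : measurable_fun setT (fun x : R => (m + s * x)%R).
Proof. by apply: measurable_funD => //; exact: measurable_funM. Qed.

(** The rescaled pushforward gives half-open intervals their length, which characterizes Lebesgue
    measure. *)
Lemma lebesgue_measure_affine m s (A : set R) : 0 < s -> measurable A ->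
  leb A = (s%:E * leb ((fun x : R => (m + s * x)%R) @^-1` A))%E.
Proof.
move=> s0 mA; have s0' : 0 <= s by exact: ltW.
pose phi : measurableTypeR R -> measurableTypeR R := fun x => m + s * x.
have mphi : measurable_fun setT phi by exact: measurable_affine.
pose mu' : {measure set (measurableTypeR R) -> \bar R} :=
  measure_function_pushforward__canonical__measure_function_Measure leb mphi.
pose nu := mscale (NngNum s0') mu'.
apply: (@lebesgue_measure_unique R nu) => // _ [[a b]] _ <-.
have pE : phi @^-1` `]a, b]%classic = `](a - m) / s, (b - m) / s]%classic.
  apply/seteqP; split => x; rewrite /phi /= !in_itv/= ltr_pdivrMr// ler_pdivlMr//.
    by rewrite (mulrC x) ltrBlDl lerBrDl.
  by rewrite (mulrC x) ltrBlDl lerBrDl.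
transitivity (s%:E * leb `]((a - m) / s)%R, ((b - m) / s)%R]%classic)%E; last first.
  by rewrite -pE.
rewrite !lebesgue_measure_itv/= !lte_fin ltr_pM2r ?invr_gt0// ltrD2r.
case: ifPn => ab; last by rewrite mule0.
rewrite -!EFinD -EFinM; congr EFin.
by field; rewrite gt_eqF.
Qed.

Lemma ge0_integral_lebesgue_affine m s f : 0 < s ->
  measurable_fun setT f -> (forall x, 0 <= f x)%E ->
  (\int[leb]_x f x = s%:E * \int[leb]_x f (m + s * x)%R)%E.
Proof.
move=> s0 mf f0; have s0' : 0 <= s by exact: ltW.
pose phi : measurableTypeR R -> measurableTypeR R := fun x => m + s * x.
have mphi : measurable_fun setT phi by exact: measurable_affine.
pose mu' : {measure set (measurableTypeR R) -> \bar R} :=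
  measure_function_pushforward__canonical__measure_function_Measure leb mphi.
transitivity (\int[mscale (NngNum s0') mu']_x f x)%E.
  apply: eq_measure_integral => A mA _; exact: lebesgue_measure_affine.
rewrite ge0_integral_mscale//=; congr (_ * _)%E.
by rewrite ge0_integral_pushforward.
Qed.

(** The change of variables produces a Radon-Nikodym derivative, which is almost everywhere
    [normal_pdf] because both have the same integral over every measurable set. *)
Lemma ge0_integral_normal_prob m s f :
  measurable_fun setT f -> (forall x, 0 <= f x)%E ->
  (\int[normal_prob m s]_x f x = \int[leb]_x (f x * (normal_pdf m s x)%:E))%E.
Proof.
move=> mf f0.
have dom := normal_prob_dominates m s.
rewrite -(Radon_Nikodym_SigmaFinite.change_of_variables dom)//.
have RNi := Radon_Nikodym_SigmaFinite.f_integrable dom.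
apply: ge0_ae_eq_integral => //.
- by apply: emeasurable_funM => //; exact: measurable_int RNi.
- apply: emeasurable_funM => //; apply/measurable_EFinP.
  exact: measurable_normal_pdf.
- by move=> x _; rewrite mule_ge0// Radon_Nikodym_SigmaFinite.f_ge0.
- by move=> x _; rewrite mule_ge0// lee_fin normal_pdf_ge0.
apply: ae_eqe_mul2l; apply: integral_ae_eq => //.
- apply/measurable_EFinP; exact: measurable_normal_pdf.
- by move=> A _ mA; rewrite -Radon_Nikodym_SigmaFinite.f_integral.
Qed.

Lemma normal_pdf_affine m s x : 0 < s ->
  normal_pdf 0 1 x = s * normal_pdf m s (m + s * x).
Proof.
move=> s0; rewrite !normal_pdfE ?gt_eqF// /normal_fun /normal_peak.
rewrite subr0 addrAC subrr add0r expr1n mul1r.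
rewrite -mulrnAr sqrtrM ?sqr_ge0// sqrtr_sqr gtr0_norm// mulrA invfM mulrA divff ?gt_eqF// mul1r.
congr (_ * expR _).
by field; rewrite gt_eqF.
Qed.

Lemma ge0_integral_normal_prob_affine m s f : 0 < s ->
  measurable_fun setT f -> (forall x, 0 <= f x)%E ->
  (\int[normal_prob 0 1]_x f (m + s * x)%R =
   \int[leb]_x (f x * (normal_pdf m s x)%:E))%E.
Proof.
move=> s0 mf f0.
have maf : measurable_fun setT (fun x => f (m + s * x)%R).
  exact: (measurableT_comp mf (measurable_affine m s)).
rewrite (ge0_integral_normal_prob 0 1 _ maf (fun x => f0 _)).
have mg : measurable_fun setT (fun x => f x * (normal_pdf m s x)%:E)%E.
  apply: emeasurable_funM => //; apply/measurable_EFinP.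
  exact: measurable_normal_pdf.
have g0 x : (0 <= f x * (normal_pdf m s x)%:E)%E.
  by rewrite mule_ge0// lee_fin normal_pdf_ge0.
rewrite [RHS](ge0_integral_lebesgue_affine m s _ s0 mg g0).
rewrite -ge0_integralZl//=.
- apply: eq_integral => x _.
  by rewrite (normal_pdf_affine m s)// EFinM muleCA.
- by apply: (measurableT_comp mg); exact: measurable_affine.
- by rewrite lee_fin ltW.
Qed.

(** Symmetry of the noise: it lets [integral_linear_sqr] cancel a cross term while handling
    nonnegative integrands only. *)
Lemma ge0_integral_normal_prob_opp f :
  measurable_fun setT f -> (forall x, 0 <= f x)%E ->
  (\int[normal_prob (0 : R) 1]_x f (- x)%R = \int[normal_prob 0 1]_x f x)%E.
Proof.
move=> mf f0.
have mNf : measurable_fun setT (fun x : R => f (- x)%R).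
  exact: (measurableT_comp mf).
rewrite (ge0_integral_normal_prob 0 1 _ mNf (fun x => f0 _)) (ge0_integral_normal_prob 0 1 _ mf f0).
have mg : measurable_fun setT (fun x => f x * (normal_pdf 0 1 x)%:E)%E.
  apply: emeasurable_funM => //; apply/measurable_EFinP.
  exact: measurable_normal_pdf.
have mN : measurable_fun setT (-%R : measurableTypeR R -> measurableTypeR R).
  exact: measurable_funN.
have g0 : {in setT, forall x : R, (0 <= f x * (normal_pdf 0 1 x)%:E)%E}.
  by move=> x _; rewrite mule_ge0// lee_fin normal_pdf_ge0.
pose mu' : {measure set (measurableTypeR R) -> \bar R} :=
  measure_function_pushforward__canonical__measure_function_Measure leb mN.
transitivity (\int[mu']_x (f x * (normal_pdf 0 1 x)%:E))%E; last first.
  by apply: eq_measure_integral => A mA _; exact: lebesgue_measureN.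
rewrite (ge0_integral_pushforward mN leb measurableT mg g0).
apply: eq_integral => x _ /=; congr (_ * _%:E)%E.
by rewrite !normal_pdfE ?oner_eq0// /normal_fun !subr0 sqrrN.
Qed.

Lemma normal_peakE s : 0 < s -> normal_peak s = s^-1 * (Num.sqrt (pi *+ 2))^-1.
Proof.
move=> s0; rewrite /normal_peak -mulrnAr sqrtrM ?sqr_ge0// sqrtr_sqr gtr0_norm//.
by rewrite invfM.
Qed.

(** Completing the square in [x]. This is Bayes' rule for a Gaussian signal in Gaussian noise: on
    the right stand the marginal density of [y] and the conditional density of [x] given [y]. *)
Lemma normal_pdf_mul m s d x y : 0 < s -> 0 < d ->
  let v := s ^+ 2 + d ^+ 2 in
  normal_pdf m s x * normal_pdf x d y =
  normal_pdf m (Num.sqrt v) y *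
  normal_pdf ((m * d ^+ 2 + y * s ^+ 2) / v) (s * d / Num.sqrt v) x.
Proof.
move=> s0 d0 v; have v0 : 0 < v by rewrite addr_gt0// exprn_gt0.
have r0 : 0 < Num.sqrt v by rewrite sqrtr_gt0.
have q0 : 0 < s * d / Num.sqrt v by rewrite divr_gt0// mulr_gt0.
rewrite !normal_pdfE ?gt_eqF// mulrACA [RHS]mulrACA; congr (_ * _).
  rewrite !normal_peakE// !invfM invrK.
  move: (Num.sqrt (pi *+ 2))^-1 => p.
  by move: (Num.sqrt v) r0 => r r0; field; rewrite !gt_eqF.
rewrite /normal_fun -!expRD; congr expR.
rewrite exprMn exprVn sqr_sqrtr ?(ltW v0)//.
move: v0; rewrite /v => v0; rewrite exprMn.
by field; rewrite !gt_eqF.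
Qed.

(** In [normal_pdf_mul] the first factor is constant in [x] and the second has total mass 1. *)
Lemma normal_pdf_convolution m s d y : 0 < s -> 0 < d ->
  (\int[leb]_x (normal_pdf m s x * normal_pdf x d y)%:E =
   (normal_pdf m (Num.sqrt (s ^+ 2 + d ^+ 2)) y)%:E)%E.
Proof.
move=> s0 d0; under eq_integral do rewrite normal_pdf_mul// EFinM.
by rewrite ge0_integralZl ?integral_normal_pdf ?mule1//;
  rewrite ?lee_fin ?normal_pdf_ge0//;
  [apply/measurable_EFinP; exact: measurable_normal_pdf
  |by move=> x _; rewrite lee_fin normal_pdf_ge0].
Qed.

(* Comparing [N(0, 1)] with [N(0, s ^+ 2)] through [1 + t <= expR t] gives
   [1 + (1 - s ^- 2) / 2 * E (Z ^+ 2) <= s] for all [s > 1]. *)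
Lemma normal_prob_second_moment :
  (\int[normal_prob (0 : R) 1]_x (x ^+ 2)%:E <= 1)%E.
Proof.
have msq : measurable_fun setT (fun x : R => (x ^+ 2)%:E).
  by apply/measurable_EFinP; exact: measurable_funX.
have key s : 1 < s -> (1 + ((1 - s ^- 2) / 2)%:E *
    \int[normal_prob (0 : R) 1]_x (x ^+ 2)%:E <= s%:E)%E.
  move=> s1; have s0 : 0 < s by exact: lt_trans s1.
  have a0 : 0 <= (1 - s ^- 2) / 2.
    by rewrite divr_ge0// subr_ge0 invf_le1 ?exprn_gt0// exprn_ege1// ltW.
  rewrite -ge0_integralZl//; last by move=> x _; rewrite lee_fin sqr_ge0.
  rewrite -{1}(@probability_setT _ _ _ (normal_prob (0:R) 1)) -[X in (X + _)%E]mul1e.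
  rewrite -integral_cst// -ge0_integralD//; last 2 first.
  - by move=> x _; rewrite mule_ge0 ?lee_fin ?sqr_ge0.
  - by apply: emeasurable_funM.
  rewrite ge0_integral_normal_prob; last 2 first.
  - by apply: emeasurable_funD => //; exact: emeasurable_funM.
  - by move=> x; rewrite adde_ge0// mule_ge0 ?lee_fin ?sqr_ge0.
  rewrite -[leRHS]mule1 -[X in (_ <= _ * X)%E](integral_normal_pdf 0 s) -ge0_integralZl//; last 3 first.
  - by apply/measurable_EFinP; exact: measurable_normal_pdf.
  - by move=> x _; rewrite lee_fin normal_pdf_ge0.
  - by rewrite lee_fin ltW.
  apply: ge0_le_integral => //.
  - move=> x _; rewrite mule_ge0 ?lee_fin ?normal_pdf_ge0//.
    by rewrite addr_ge0// mulr_ge0// sqr_ge0.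
  - apply: emeasurable_funM.
      by apply: emeasurable_funD => //; exact: emeasurable_funM.
    by apply/measurable_EFinP; exact: measurable_normal_pdf.
  - apply: emeasurable_funM => //.
    by apply/measurable_EFinP; exact: measurable_normal_pdf.
  move=> x _ /=; rewrite lee_fin.
  rewrite !normal_pdfE ?gt_eqF// !normal_peakE// invr1 mul1r.
  rewrite mulrCA -[s^-1 * _ * _]mulrA mulVKf ?gt_eqF// ler_wpM2l ?invr_ge0 ?sqrtr_ge0//.
  rewrite /normal_fun !subr0 expr1n.
  have -> : - x ^+ 2 / (s ^+ 2 *+ 2) =
      (1 - s ^- 2) / 2 * x ^+ 2 + - x ^+ 2 / (1 *+ 2).
    by field; rewrite gt_eqF.
  by rewrite expRD ler_wpM2r ?expR_ge0// expR_ge1Dx.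
have M0 : (0 <= \int[normal_prob (0 : R) 1]_x (x ^+ 2)%:E)%E.
  by apply: integral_ge0 => x _; rewrite lee_fin sqr_ge0.
move: M0 key; case: (\int[_]_x _)%E => [M|_|]; last 2 first.
- move=> /(_ 2); rewrite ltr1n => /(_ isT).
  by rewrite gt0_muley ?addey// lte_fin divr_gt0// subr_gt0 invf_lt1 ?exprn_gt0// exprn_egt1// ltr1n.
- by rewrite leeNy_eq.
rewrite !lee_fin => M0 key; apply/ler_addgt0Pr => e e0.
have := key (1 + e / 2); rewrite ltrDl divr_gt0// => /(_ isT).
rewrite -EFinM -EFinD lee_fin.
set s := 1 + e / 2 => h.
have s1 : 1 < s by rewrite /s ltrDl divr_gt0.
have s0 : 0 < s by exact: lt_trans s1.
(* Cancelling [s - 1] leaves [M <= 2 s^2 / (s + 1)], which is at most [2 s - 1 = 1 + e]. *)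
have {h} : (s - 1) * (M * (s + 1)) <= (s - 1) * (2 * s ^+ 2).
  have -> : (s - 1) * (M * (s + 1)) = (1 - s ^- 2) / 2 * M * (2 * s ^+ 2).
    by field; rewrite gt_eqF.
  apply: ler_wpM2r; first by rewrite mulr_ge0// sqr_ge0.
  by rewrite lerBrDl.
rewrite ler_pM2l ?subr_gt0// => h.
have -> : 1 + e = 2 * s - 1 by rewrite /s; field.
nra.
Qed.

End normal_integrals.

(** * Bayes estimation in Gaussian noise *)

Section conditional_expectation_unique.
Context {d} {T : measurableType d} {R : realType}.
Variables (P : probability T R) (X Y : T -> R).
Hypothesis mY : measurable_fun setT Y.

Lemma g_sigma_algebra_preimage_measurable A :
  g_sigma_algebra_preimage Y A -> measurable A.
Proof. by move=> [C mC <-]; exact: mY. Qed.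

Lemma measurable_g_sigma_algebra_preimage (g : T -> R) :
  measurable_fun [set: g_sigma_algebra_preimageType Y] g -> measurable_fun setT g.
Proof.
move=> mg _ C mC; apply: g_sigma_algebra_preimage_measurable.
exact: (mg measurableT C mC).
Qed.

(** Pushing [P] along this identity map restricts it to the sigma-algebra generated by [Y]. *)
Let coarsen : T -> g_sigma_algebra_preimageType Y := idfun.

Let mcoarsen : measurable_fun setT coarsen.
Proof.
by move=> _ A mA; rewrite setTI; exact: g_sigma_algebra_preimage_measurable.
Qed.

Let P' : {measure set (g_sigma_algebra_preimageType Y) -> \bar R} :=
  measure_function_pushforward__canonical__measure_function_Measure P mcoarsen.

(** For the restricted measure, equal integrals over all measurable sets force almost everywhere
    equality; the exceptional set found there is also [P]-negligible. *)
Lemma cond_expectation_unique (g1 g2 : T -> R) :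
  is_cond_expectation P X Y g1 -> is_cond_expectation P X Y g2 ->
  ae_eq P setT (EFin \o g1) (EFin \o g2).
Proof.
move=> [mg1 ig1 Eg1] [mg2 ig2 Eg2].
have push (g : T -> R) A : measurable_fun [set: g_sigma_algebra_preimageType Y] g ->
    P.-integrable setT (EFin \o g) -> g_sigma_algebra_preimage Y A ->
    (\int[P']_(w in A) (g w)%:E = \int[P]_(w in A) (g w)%:E)%E.
  move=> mg ig mA.
  have mgE : measurable_fun [set: g_sigma_algebra_preimageType Y] (EFin \o g).
    exact/measurable_EFinP.
  have igA : P.-integrable (coarsen @^-1` A) ((EFin \o g) \o coarsen).
    by apply: integrableS ig => //; exact: g_sigma_algebra_preimage_measurable.
  exact: (@integral_pushforward _ _ _ _ _ _ mcoarsen P _ _ mgE igA mA).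
have i1 : P'.-integrable setT (EFin \o g1).
  have mgE : measurable_fun [set: g_sigma_algebra_preimageType Y] (EFin \o g1).
    exact/measurable_EFinP.
  have igA : P.-integrable (coarsen @^-1` setT) ((EFin \o g1) \o coarsen).
    exact: ig1.
  exact: (@integrable_pushforward _ _ _ _ _ _ mcoarsen P _ _ mgE igA measurableT).
have [N [mN PN sN]] : ae_eq P' setT (EFin \o g1) (EFin \o g2).
  apply: integral_ae_eq => //; first exact/measurable_EFinP.
  move=> U _ mU.
  by rewrite (push _ _ mg1 ig1 mU) (push _ _ mg2 ig2 mU) Eg1// Eg2.
exists N; split => //.
exact: g_sigma_algebra_preimage_measurable.
Qed.

End conditional_expectation_unique.

(** * Posterior moments and Bayes risk at a fixed noise level *)

Section gaussian_channel.
Context {R : realType}.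
Variables (pi : probability (measurableTypeR R) R) (s : R).
Hypothesis s_gt0 : 0 < s.
Local Notation leb := (@lebesgue_measure R).
Local Notation P := (pi \x normal_prob (0 : R) 1)%E.
Local Notation obs := (fun w : R * R => w.1 + s * w.2).
Local Notation p := (fun b y : R => normal_pdf b s y).

Lemma measurable_obs : measurable_fun setT obs.
Proof. by apply: measurable_funD => //; apply: measurable_funM. Qed.

Lemma measurable_normal_pdf2 :
  measurable_fun setT (fun w : R * R => normal_pdf w.1 s w.2).
Proof.
under eq_fun do rewrite normal_pdfE ?gt_eqF//.
apply: measurable_funM => //.
apply: measurableT_comp => //; apply: measurable_funM => //.
apply: measurableT_comp => //; apply: measurable_funX.
exact: measurable_funB.
Qed.

(** Signal and observation have joint density [p] with respect to [pi \x leb]: by Tonelli this is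
    the affine substitution in the noise for each fixed signal [b]. *)
Lemma ge0_integral_obs (f : R * R -> \bar R) :
  measurable_fun setT f -> (forall w, 0 <= f w)%E ->
  (\int[P]_w f (w.1, obs w) =
   \int[pi \x leb]_w (f w * (normal_pdf w.1 s w.2)%:E))%E.
Proof.
move=> mf f0.
have mf' : measurable_fun setT (fun w => f (w.1, obs w)).
  apply: (measurableT_comp mf); apply: measurable_fun_pair => //.
  exact: measurable_obs.
have mfp : measurable_fun setT (fun w : R * R => f w * (normal_pdf w.1 s w.2)%:E)%E.
  apply: emeasurable_funM => //; apply/measurable_EFinP.
  exact: measurable_normal_pdf2.
have fp0 w : (0 <= f w * (normal_pdf w.1 s w.2)%:E)%E.
  by rewrite mule_ge0// lee_fin normal_pdf_ge0.
transitivity (\int[pi]_b \int[normal_prob 0 1]_z f (b, b + s * z)%R)%E.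
  exact: (@fubini_tonelli1 _ _ _ _ R pi (normal_prob 0 1) _ mf' (fun w => f0 _)).
transitivity (\int[pi]_b \int[leb]_y (f (b, y) * (normal_pdf b s y)%:E))%E.
  apply: eq_integral => b _.
  apply: (ge0_integral_normal_prob_affine b s (fun y => f (b, y)) s_gt0).
    exact: measurableT_comp.
  by move=> y; exact: f0.
by apply/esym; exact: (@fubini_tonelli1 _ _ _ _ R pi leb _ mfp fp0).
Qed.

Lemma integral_obs (f : R * R -> \bar R) : measurable_fun setT f ->
  (\int[P]_w f (w.1, obs w) =
   \int[pi \x leb]_w (f w * (normal_pdf w.1 s w.2)%:E))%E.
Proof.
move=> mf.
have mpE (g : R * R -> \bar R) w : (g^\+ w * (normal_pdf w.1 s w.2)%:E =
    (fun w => g w * (normal_pdf w.1 s w.2)%:E)^\+ w)%E.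
  by rewrite !funeposE maxe_pMl ?mul0e// lee_fin normal_pdf_ge0.
have mnE (g : R * R -> \bar R) w : (g^\- w * (normal_pdf w.1 s w.2)%:E =
    (fun w => g w * (normal_pdf w.1 s w.2)%:E)^\- w)%E.
  by rewrite !funenegE -mulNe maxe_pMl ?mul0e// lee_fin normal_pdf_ge0.
transitivity (\int[P]_w (fun w => f (w.1, obs w))^\+ w -
    \int[P]_w (fun w => f (w.1, obs w))^\- w)%E; first exact: integralE.
transitivity (\int[pi \x leb]_w (fun w => f w * (normal_pdf w.1 s w.2)%:E)^\+ w -
    \int[pi \x leb]_w (fun w => f w * (normal_pdf w.1 s w.2)%:E)^\- w)%E;
  last by apply/esym; exact: integralE.
apply: (f_equal2 (fun a b => a - b)%E).
  transitivity (\int[P]_w (f^\+)%E (w.1, obs w))%E.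
    by apply: eq_integral => w _; rewrite !funeposE.
  rewrite (ge0_integral_obs _ (measurable_funepos mf) (funepos_ge0 _)).
  by apply: eq_integral => w _; exact: mpE.
transitivity (\int[P]_w (f^\-)%E (w.1, obs w))%E.
  by apply: eq_integral => w _; rewrite !funenegE.
rewrite (ge0_integral_obs _ (measurable_funeneg mf) (funeneg_ge0 _)).
by apply: eq_integral => w _; exact: mnE.
Qed.

Lemma integrable_obs (f : R * R -> \bar R) : measurable_fun setT f ->
  P.-integrable setT (fun w => f (w.1, obs w)) ->
  (pi \x leb)%E.-integrable setT (fun w => f w * (normal_pdf w.1 s w.2)%:E)%E.
Proof.
move=> mf /integrableP[_ fi]; apply/integrableP; split.
  apply: emeasurable_funM => //; apply/measurable_EFinP.
  exact: measurable_normal_pdf2.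
have maf : measurable_fun setT (fun w => `|f w|%E) by exact: measurableT_comp.
have aE : (\int[pi \x leb]_w `|f w * (normal_pdf w.1 s w.2)%:E| =
    \int[P]_w `|f (w.1, obs w)|)%E.
  rewrite (ge0_integral_obs _ maf (fun w => abse_ge0 _)).
  by apply: eq_integral => w _; rewrite abseM [X in (_ * X)%E]gee0_abs// lee_fin normal_pdf_ge0.
exact: (eq_ind_r (fun x => (x < +oo)%E) fi aE).
Qed.

Hypothesis pi2 : (\int[pi]_b (b ^+ 2)%:E < +oo)%E.

(** Unnormalized: [moment 0] is the density of the observation, and [moment k / moment 0] is the
    posterior moment of order [k]. *)
Definition moment (k : nat) (y : R) : R := \int[pi]_b (b ^+ k * p b y).

(** The conditional risk of the estimate [c] weighted by the density of the observation, so that its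
    integral over [y] is the total risk. Extended real values suit Tonelli's theorem. *)
Definition posterior_risk (c y : R) : \bar R :=
  (\int[pi]_b ((c - b) ^+ 2 * p b y)%:E)%E.

Definition bayes_estimator (y : R) : R := moment 1 y / moment 0 y.

Let mp y : measurable_fun setT (fun b : R => p b y).
Proof.
exact: (measurableT_comp measurable_normal_pdf2 (pair2_measurable y)).
Qed.

Lemma integrable_sqr : pi.-integrable setT (fun b : R => (b ^+ 2)%:E).
Proof.
apply/integrableP; split; first by apply/measurable_EFinP; exact: measurable_funX.
by under eq_integral do rewrite gee0_abs ?lee_fin ?sqr_ge0//.
Qed.

Let expn_le (b : R) (k : nat) : (k <= 2)%N -> `|b ^+ k| <= 1 + b ^+ 2.
Proof.
case: k => [|[|[|//]]] _; rewrite ?expr0 ?expr1.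
- by rewrite normr1 lerDl sqr_ge0.
- by rewrite ler_norml; apply/andP; split; nra.
- by rewrite ger0_norm ?sqr_ge0// lerDr.
Qed.

Let integrable_1sqr r : pi.-integrable setT (fun b : R => (r * (1 + b ^+ 2))%:E).
Proof.
have i1 : pi.-integrable setT (fun _ : R => 1%:E).
  exact: (finite_measure_integrable_cst pi 1 measurableT).
exact: (integrableZl measurableT r (integrableD measurableT i1 integrable_sqr)).
Qed.

Lemma integrable_moment k y : (k <= 2)%N ->
  pi.-integrable setT (EFin \o (fun b : R => b ^+ k * p b y)).
Proof.
move=> k2; apply: (le_integrable measurableT _ _ (integrable_1sqr (normal_peak s))).
  by apply/measurable_EFinP; apply: measurable_funM; [exact: measurable_funX|exact: mp].
move=> b _ /=; rewrite lee_fin normrM mulrC.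
rewrite (ger0_norm (normal_pdf_ge0 _ _ _)) [leRHS]ger0_norm; last first.
  by rewrite mulr_ge0 ?normal_peak_ge0// addr_ge0// sqr_ge0.
by rewrite ler_pM ?normal_pdf_ge0 ?normal_pdf_ub ?gt_eqF ?expn_le.
Qed.

(** Fubini gives measurability from joint integrability, which reduces to that of [b ^+ k] because
    the density in [y] has mass 1. *)
Lemma measurable_moment k : (k <= 2)%N -> measurable_fun setT (moment k).
Proof.
move=> k2.
have mf : measurable_fun setT (fun w : R * R => (w.1 ^+ k * p w.1 w.2)%:E).
  apply/measurable_EFinP; apply: measurable_funM.
    exact: measurable_funX.
  exact: measurable_normal_pdf2.
have fi : (pi \x leb)%E.-integrable setT (fun w : R * R => (w.1 ^+ k * p w.1 w.2)%:E).
  apply/(@integrable12ltyP _ _ _ _ _ pi leb _ mf).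
  have /integrableP[_ bk] : pi.-integrable setT (fun b : R => (b ^+ k)%:E).
    apply: (le_integrable measurableT _ _ (integrable_1sqr 1)).
      by apply/measurable_EFinP; exact: measurable_funX.
    move=> b _; rewrite lee_fin mul1r [leRHS]ger0_norm; first exact: expn_le.
    by rewrite addr_ge0// sqr_ge0.
  have aE : (\int[pi]_b \int[leb]_y `|(b ^+ k * p b y)%:E| =
      \int[pi]_b `|(b ^+ k)%:E|)%E.
    apply: eq_integral => b _; rewrite -[RHS]mule1 -(integral_normal_pdf b s).
    rewrite -ge0_integralZl//=.
    - apply: eq_integral => y _.
      by rewrite normrM EFinM [X in (_ * X%:E)%E]ger0_norm// normal_pdf_ge0.
    - by apply/measurable_EFinP; exact: measurable_normal_pdf.
    - by move=> y _; rewrite lee_fin normal_pdf_ge0.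
  exact: (eq_ind_r (fun x => (x < +oo)%E) bk aE).
have mG := @measurable_fubini_G _ _ _ _ _ pi leb _ fi.
exact: (measurableT_comp (fine_measurable measurableT) mG).
Qed.

Lemma posterior_riskE c y :
  posterior_risk c y = (c ^+ 2 * moment 0 y - 2 * c * moment 1 y + moment 2 y)%:E.
Proof.
have i0 := integrable_moment 0 y isT; have i1 := integrable_moment 1 y isT.
have i2 := integrable_moment 2 y isT.
have iZ (f : R -> R) r : pi.-integrable setT (EFin \o f) ->
    pi.-integrable setT (EFin \o (fun b => r * f b)).
  by move=> fi; exact: (integrableZl measurableT r fi).
have i01 : pi.-integrable setT
    (EFin \o (fun b => c ^+ 2 * (b ^+ 0 * p b y) - 2 * c * (b ^+ 1 * p b y))).
  exact: (integrableB measurableT (iZ _ _ i0) (iZ _ _ i1)).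
have -> : c ^+ 2 * moment 0 y - 2 * c * moment 1 y + moment 2 y =
    \int[pi]_b (c ^+ 2 * (b ^+ 0 * p b y) - 2 * c * (b ^+ 1 * p b y) + b ^+ 2 * p b y).
  rewrite (RintegralD measurableT i01 i2).
  rewrite (RintegralB measurableT (iZ _ (c ^+ 2) i0) (iZ _ (2 * c) i1)).
  by rewrite (RintegralZl _ measurableT i0) (RintegralZl _ measurableT i1).
rewrite /Rintegral fineK; last first.
  exact: (integrable_fin_num measurableT (integrableD measurableT i01 i2)).
by apply: eq_integral => b _; congr EFin; ring.
Qed.

Lemma moment0_ge0 y : 0 <= moment 0 y.
Proof. by apply: Rintegral_ge0 => b _; rewrite expr0 mul1r normal_pdf_ge0. Qed.

Lemma posterior_risk_ge0 c y : (0 <= posterior_risk c y)%E.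
Proof.
by apply: integral_ge0 => b _; rewrite lee_fin mulr_ge0 ?sqr_ge0 ?normal_pdf_ge0.
Qed.

(** The point is the case [moment 0 y = 0], where the quotient takes its default value 0: there
    [posterior_risk] is affine in [c] and nonnegative, so its slope, a multiple of [moment 1 y],
    vanishes. *)
Lemma bayes_estimatorE y : bayes_estimator y * moment 0 y = moment 1 y.
Proof.
rewrite /bayes_estimator; have [m0|m0] := eqVneq (moment 0 y) 0; last by rewrite divfK.
rewrite m0 mulr0; apply/eqP; rewrite eq_sym; apply/negPn/negP => m1.
(* At this [c] the affine risk would equal -1. *)
have := posterior_risk_ge0 ((moment 2 y + 1) / (2 * moment 1 y)) y.
rewrite posterior_riskE lee_fin m0 mulr0 add0r.
rewrite (_ : _ + _ = - 1); first by lra.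
by field.
Qed.

(** Completing the square: the two risks differ by [moment 0 y * (c - bayes_estimator y) ^+ 2]. *)
Lemma bayes_estimator_optimal c y :
  (posterior_risk (bayes_estimator y) y <= posterior_risk c y)%E.
Proof.
rewrite !posterior_riskE lee_fin -bayes_estimatorE.
have := mulr_ge0 (moment0_ge0 y) (sqr_ge0 (c - bayes_estimator y)).
lra.
Qed.

Lemma measurable_bayes_estimator : measurable_fun setT bayes_estimator.
Proof.
apply: measurable_funM; first exact: measurable_moment.
by apply: measurable_funV; exact: measurable_moment.
Qed.

Let msqr (k : R -> R) : measurable_fun setT k ->
  measurable_fun setT (fun w : R * R => ((k w.2 - w.1) ^+ 2)%:E).
Proof.
move=> mk; apply/measurable_EFinP; apply: measurable_funX.
by apply: measurable_funB => //; exact: measurableT_comp.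
Qed.

Let msqrp (k : R -> R) : measurable_fun setT k ->
  measurable_fun setT (fun w : R * R => ((k w.2 - w.1) ^+ 2 * p w.1 w.2)%:E).
Proof.
move=> mk; apply/measurable_EFinP; apply: measurable_funM.
  by have /measurable_EFinP := msqr k mk.
exact: measurable_normal_pdf2.
Qed.

Lemma measurable_posterior_risk (k : R -> R) : measurable_fun setT k ->
  measurable_fun setT (fun y => posterior_risk (k y) y).
Proof.
move=> mk.
have h0 (w : R * R) : (0 <= ((k w.2 - w.1) ^+ 2 * p w.1 w.2)%:E)%E.
  by rewrite lee_fin mulr_ge0 ?sqr_ge0 ?normal_pdf_ge0.
exact: (@measurable_fun_fubini_tonelli_G _ _ _ _ R pi _ (msqrp k mk) h0).
Qed.

Lemma integral_sqr_error (k : R -> R) : measurable_fun setT k ->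
  (\int[P]_w ((k (obs w) - w.1) ^+ 2)%:E =
   \int[leb]_y posterior_risk (k y) y)%E.
Proof.
move=> mk.
have f0 (w : R * R) : (0 <= ((k w.2 - w.1) ^+ 2)%:E)%E.
  by rewrite lee_fin sqr_ge0.
apply: (eq_trans (ge0_integral_obs _ (msqr k mk) f0)).
have h0 (w : R * R) : (0 <= ((k w.2 - w.1) ^+ 2 * p w.1 w.2)%:E)%E.
  by rewrite lee_fin mulr_ge0 ?sqr_ge0 ?normal_pdf_ge0.
transitivity (\int[pi \x leb]_w ((k w.2 - w.1) ^+ 2 * p w.1 w.2)%:E)%E.
  by apply: eq_integral => w _; rewrite EFinM.
exact: (@fubini_tonelli2 _ _ _ _ R pi leb _ (msqrp k mk) h0).
Qed.

Definition bayes_risk : \bar R :=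
  (\int[leb]_y posterior_risk (bayes_estimator y) y)%E.

Lemma bayes_risk_le (k : R -> R) : measurable_fun setT k ->
  (bayes_risk <= \int[P]_w ((k (obs w) - w.1) ^+ 2)%:E)%E.
Proof.
move=> mk; rewrite (integral_sqr_error k mk); apply: ge0_le_integral => //.
- by move=> y _; exact: posterior_risk_ge0.
- exact: measurable_posterior_risk _ measurable_bayes_estimator.
- exact: measurable_posterior_risk.
- by move=> y _; exact: bayes_estimator_optimal.
Qed.

(** Adding the integral to its reflection under [z -> - z] cancels the cross term pointwise; the
    second moment of the noise is then bounded by 1. *)
Lemma integral_linear_sqr (c d : R) :
  (\int[normal_prob 0 1]_z ((c + d * z) ^+ 2)%:E <= (c ^+ 2 + d ^+ 2)%:E)%E.
Proof.
pose N : probability (measurableTypeR R) R := normal_prob (0 : R) 1.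
have mq (r : R) : measurable_fun setT (fun z : R => ((c + r * z) ^+ 2)%:E).
  by apply/measurable_EFinP; apply: measurable_funX; exact: measurable_affine.
have q0 (r z : R) : (0 <= ((c + r * z) ^+ 2)%:E)%E by rewrite lee_fin sqr_ge0.
have sym : (\int[N]_z ((c + - d * z) ^+ 2)%:E = \int[N]_z ((c + d * z) ^+ 2)%:E)%E.
  rewrite -(ge0_integral_normal_prob_opp _ (mq d) (q0 d)).
  by apply: eq_integral => z _; rewrite mulrN mulNr.
have mz : measurable_fun setT (fun z : R => (z ^+ 2)%:E).
  by apply/measurable_EFinP; exact: measurable_funX.
have z0 (z : R) : [set: R] z -> (0 <= (z ^+ 2)%:E)%E by rewrite lee_fin sqr_ge0.
have dbl : (\int[N]_z ((c + d * z) ^+ 2)%:E + \int[N]_z ((c + d * z) ^+ 2)%:E =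
    (2 * c ^+ 2)%:E + (2 * d ^+ 2)%:E * \int[N]_z (z ^+ 2)%:E)%E.
  rewrite -{2}sym -(ge0_integralD N measurableT (fun z _ => q0 d z) (mq d)
    (fun z _ => q0 (- d) z) (mq (- d))).
  have d0 : (0 <= (2 * d ^+ 2)%:E)%E by rewrite lee_fin mulr_ge0 ?sqr_ge0.
  rewrite -(ge0_integralZl N measurableT mz z0 d0).
  have -> : (2 * c ^+ 2)%:E = (\int[N]_z (cst (2 * c ^+ 2)%:E z))%E.
    by rewrite integral_cst// [X in (_ * X)%E]probability_setT mule1.
  have mdz : measurable_fun setT (fun z : R => (2 * d ^+ 2)%:E * (z ^+ 2)%:E)%E.
    exact: emeasurable_funM.
  rewrite -ge0_integralD//.
  - by apply: eq_integral => z _ /=; rewrite -EFinD; congr EFin; ring.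
  - by move=> z _; rewrite lee_fin mulr_ge0 ?sqr_ge0.
  - by move=> z zT; rewrite mule_ge0 ?z0.
have : (\int[N]_z ((c + d * z) ^+ 2)%:E + \int[N]_z ((c + d * z) ^+ 2)%:E <=
    (2 * c ^+ 2)%:E + (2 * d ^+ 2)%:E)%E.
  rewrite dbl leeD2l// -[leRHS]mule1 lee_wpmul2l ?normal_prob_second_moment//.
  by rewrite lee_fin mulr_ge0 ?sqr_ge0.
rewrite -/N; case: (\int[N]_z _)%E => [r|//|_]; last by rewrite leNye.
by rewrite -!EFinD !lee_fin; lra.
Qed.

Let v := fine (\int[pi]_b (b ^+ 2)%:E)%E.

Lemma linear_risk (a : R) :
  (\int[P]_w ((a * obs w - w.1) ^+ 2)%:E <=
   ((1 - a) ^+ 2 * v + a ^+ 2 * s ^+ 2)%:E)%E.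
Proof.
have mf : measurable_fun setT (fun w : R * R => ((a * obs w - w.1) ^+ 2)%:E).
  apply/measurable_EFinP; apply: measurable_funX.
  apply: measurable_funB => //; apply: measurable_funM => //.
  exact: measurable_obs.
have f0 (w : R * R) : (0 <= ((a * obs w - w.1) ^+ 2)%:E)%E by rewrite lee_fin sqr_ge0.
rewrite (@fubini_tonelli1 _ _ _ _ R pi (normal_prob 0 1) _ mf f0).
have vE : (\int[pi]_b (b ^+ 2)%:E = v%:E)%E.
  rewrite /v fineK// ge0_fin_numE//.
  by apply: integral_ge0 => b _; rewrite lee_fin sqr_ge0.
have sq0 (b : R) : [set: R] b -> (0 <= (b ^+ 2)%:E)%E by rewrite lee_fin sqr_ge0.
have msq : measurable_fun setT (fun b : R => (b ^+ 2)%:E).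
  by apply/measurable_EFinP; exact: measurable_funX.
have a0 : (0 <= ((1 - a) ^+ 2)%:E)%E by rewrite lee_fin sqr_ge0.
have maff : measurable_fun setT (fun b : R => ((1 - a) ^+ 2)%:E * (b ^+ 2)%:E)%E.
  exact: emeasurable_funM.
have -> : ((1 - a) ^+ 2 * v + a ^+ 2 * s ^+ 2)%:E =
    (\int[pi]_b (((1 - a) ^+ 2)%:E * (b ^+ 2)%:E + cst (a ^+ 2 * s ^+ 2)%:E b))%E.
  rewrite ge0_integralD//.
  - rewrite (ge0_integralZl pi measurableT msq sq0 a0) vE integral_cst//.
    by rewrite [X in (_ + _ * X)%E]probability_setT mule1.
  - by move=> b bT; rewrite mule_ge0 ?sq0.
  - by move=> b _; rewrite lee_fin mulr_ge0 ?sqr_ge0.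
apply: ge0_le_integral => //.
- by move=> b _; exact: integral_ge0.
- exact: (@measurable_fun_fubini_tonelli_F _ _ _ _ R (normal_prob 0 1) _ mf f0).
- exact: emeasurable_funD.
move=> b _; rewrite /fubini_F/=.
(* For fixed [b] the error of the linear estimator is the affine function [(a - 1) b + a s z] of the
   noise. *)
apply: (@le_trans _ _ ((((a - 1) * b) ^+ 2 + (a * s) ^+ 2)%:E)).
  apply: le_trans (integral_linear_sqr ((a - 1) * b) (a * s)).
  rewrite le_eqVlt; apply/orP; left; apply/eqP.
  by apply: eq_integral => z _; congr (_ %:E); ring.
by rewrite lee_fin le_eqVlt; apply/orP; left; apply/eqP; ring.
Qed.

Lemma bayes_risk_ge0 : (0 <= bayes_risk)%E.
Proof. by apply: integral_ge0 => y _; exact: posterior_risk_ge0. Qed.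

Lemma bayes_risk_linear (a : R) :
  (bayes_risk <= ((1 - a) ^+ 2 * v + a ^+ 2 * s ^+ 2)%:E)%E.
Proof.
apply: le_trans (linear_risk a).
by apply: (bayes_risk_le (fun y => a * y)); exact: measurable_funM.
Qed.

Lemma bayes_risk_fin : bayes_risk \is a fin_num.
Proof.
rewrite ge0_fin_numE ?bayes_risk_ge0//.
by apply: le_lt_trans (bayes_risk_linear 0) _; rewrite ltry.
Qed.

Lemma bayes_risk_bound : (v + s ^+ 2) * fine bayes_risk <= v * s ^+ 2.
Proof.
have v0 : 0 <= v.
  by rewrite fine_ge0//; apply: integral_ge0 => b _; rewrite lee_fin sqr_ge0.
have s20 : 0 < s ^+ 2 by exact: exprn_gt0.
have vs : 0 < v + s ^+ 2 by rewrite ltr_wpDl.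
(* The coefficient that minimizes the bound of [bayes_risk_linear]; the minimum is
   [v s^2 / (v + s^2)]. *)
set a := v / (v + s ^+ 2).
have h : fine bayes_risk <= (1 - a) ^+ 2 * v + a ^+ 2 * s ^+ 2.
  by rewrite -lee_fin (fineK bayes_risk_fin) bayes_risk_linear.
apply: (le_trans (ler_wpM2l (ltW vs) h)); rewrite /a.
rewrite le_eqVlt; apply/orP; left; apply/eqP.
by field; rewrite gt_eqF.
Qed.

End gaussian_channel.

(** * The posterior mean as conditional expectation *)

Section posterior_mean.
Context {R : realType}.
Variables (pi : probability (measurableTypeR R) R) (s : R).
Hypothesis s_gt0 : 0 < s.
Hypothesis pi2 : (\int[pi]_b (b ^+ 2)%:E < +oo)%E.
Local Notation leb := (@lebesgue_measure R).
Local Notation P := (pi \x normal_prob (0 : R) 1)%E.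
Local Notation obs := (fun w : R * R => w.1 + s * w.2).
Local Notation p := (fun b y : R => normal_pdf b s y).

Lemma integral_moment (k : nat) (r y : R) : (k <= 2)%N ->
  (\int[pi]_b (r * (b ^+ k * p b y))%:E = (r * moment pi s k y)%:E)%E.
Proof.
move=> k2; have mi := integrable_moment pi s s_gt0 pi2 k y k2.
under eq_integral do rewrite EFinM.
rewrite (integralZl measurableT mi) EFinM /moment /Rintegral fineK//.
exact: (integrable_fin_num measurableT mi).
Qed.

(** The sets generated by the observation are these preimages. Integrating over [b] first lets every
    factor depending on [y] alone be taken out. *)
Lemma integral_obs_preimage (f : R * R -> R) (C : set R) : measurable C ->
  measurable_fun setT f ->
  P.-integrable setT (fun w => (f (w.1, obs w))%:E) ->
  (\int[P]_(w in setT `&` obs @^-1` C) (f (w.1, obs w))%:E =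
   \int[leb]_y \int[pi]_b (f (b, y) * \1_C y * p b y)%:E)%E.
Proof.
move=> mC mf fi.
pose g (w : R * R) := (f w * \1_C w.2)%:E.
have m1 : measurable_fun setT (fun w : R * R => \1_C w.2 : R).
  by apply: (measurableT_comp (f := \1_C : R -> R)) => //; exact: measurable_indic.
have mg : measurable_fun setT g.
  by apply/measurable_EFinP; exact: measurable_funM.
have mo : measurable_fun setT (fun w : R * R => (w.1, obs w)).
  by apply: measurable_fun_pair => //; exact: measurable_obs.
have gi : P.-integrable setT (fun w => g (w.1, obs w)).
  apply: (le_integrable measurableT _ _ fi).
    exact: (measurableT_comp mg mo).
  move=> w _; rewrite /g lee_fin normrM ler_piMr//=.
  by rewrite indicE; case: (_ \in _); rewrite ?normr1 ?normr0.
transitivity (\int[P]_w g (w.1, obs w))%E.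
  rewrite setTI integral_mkcond; apply: eq_integral => w _.
  rewrite /g patchE /= indicE.
  have -> : (w \in obs @^-1` C) = (obs w \in C) by apply/idP/idP; rewrite !inE.
  by case: ifPn => _; rewrite ?mulr1 ?mulr0.
rewrite (integral_obs pi s s_gt0 g mg).
have ii := integrable_obs pi s s_gt0 g mg gi.
apply: (eq_trans (esym (@integral21_prod_meas1 _ _ _ _ _ pi leb _ ii))).
by apply: eq_integral => y _; apply: eq_integral => b _ /=; rewrite /g EFinM.
Qed.

Lemma integrable_sqr_error (k : R -> R) : measurable_fun setT k ->
  (\int[P]_w ((k (obs w) - w.1) ^+ 2)%:E < +oo)%E ->
  P.-integrable setT (fun w => ((k (obs w) - w.1) ^+ 2)%:E).
Proof.
move=> mk fi; apply/integrableP; split.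
  apply/measurable_EFinP; apply: measurable_funX; apply: measurable_funB => //.
  by apply: (measurableT_comp mk); exact: measurable_obs.
by under eq_integral do rewrite gee0_abs ?lee_fin ?sqr_ge0//.
Qed.

Let sqr_error_bayes :
  P.-integrable setT (fun w => ((bayes_estimator pi s (obs w) - w.1) ^+ 2)%:E).
Proof.
have mb := measurable_bayes_estimator pi s s_gt0 pi2.
apply: integrable_sqr_error => //.
rewrite (integral_sqr_error pi s s_gt0 _ mb) -/(bayes_risk pi s).
by rewrite -ge0_fin_numE ?bayes_risk_ge0// bayes_risk_fin.
Qed.

Let sqr_signal : P.-integrable setT (fun w : R * R => (w.1 ^+ 2)%:E).
Proof.
have : P.-integrable setT (fun w => ((0 - w.1) ^+ 2)%:E).
  apply: (integrable_sqr_error (fun=> 0)); first exact: measurable_cst.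
  have := linear_risk pi s pi2 0 => /le_lt_trans h.
  apply: le_lt_trans (h _ (ltry _)).
  by rewrite le_eqVlt; apply/orP; left; apply/eqP; apply: eq_integral => w _; rewrite mul0r.
by apply: eq_integrable => // w _; rewrite sub0r sqrrN.
Qed.

Let integrable_domr (f : R * R -> R) (g : R * R -> R) : measurable_fun setT f ->
  (forall w, `|f w| <= 1 + g w) -> P.-integrable setT (fun w => (g w)%:E) ->
  P.-integrable setT (EFin \o f).
Proof.
move=> mf fg gi.
pose P' : probability (measurableTypeR R * measurableTypeR R)%type R := P.
have i1 := @finite_measure_integrable_cst _ _ _ P' setT 1 measurableT.
have ig := integrableD measurableT i1 gi.
apply: (le_integrable measurableT _ _ ig).
  exact/measurable_EFinP.
move=> w _ /=; rewrite lee_fin; apply: (le_trans (fg w)).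
by rewrite ler_norm.
Qed.

Let integrable_signal : P.-integrable setT (fun w : R * R => (w.1)%:E).
Proof.
apply: (integrable_domr fst (fun w => w.1 ^+ 2)) => // w.
by rewrite ler_norml; apply/andP; split; nra.
Qed.

Let integrable_bayes :
  P.-integrable setT (fun w : R * R => (bayes_estimator pi s (obs w))%:E).
Proof.
have mb := measurable_bayes_estimator pi s s_gt0 pi2.
have i2 := integrableD measurableT sqr_error_bayes sqr_signal.
have i3 := integrableZl measurableT 2 i2.
apply: (integrable_domr (fun w => bayes_estimator pi s (obs w)) _ _ _ i3).
  by apply: (measurableT_comp mb); exact: measurable_obs.
move=> w; set e := bayes_estimator _ _ _.
(* The two sides differ by [(e - 2 * w.1) ^+ 2]. *)
have : e ^+ 2 <= 2 * ((e - w.1) ^+ 2 + w.1 ^+ 2) by have := sqr_ge0 (e - 2 * w.1); lra.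
by move=> h; rewrite ler_norml; apply/andP; split; nra.
Qed.

(** After [integral_obs_preimage] the averaging identity reduces, for each [y], to
    [bayes_estimatorE]. *)
Lemma is_cond_expectation_bayes :
  is_cond_expectation P (fun w : R * R => w.1) obs
    (fun w => bayes_estimator pi s (obs w)).
Proof.
have mb := measurable_bayes_estimator pi s s_gt0 pi2.
split => [_ C mC| |A [C mC <-]].
- exists (bayes_estimator pi s @^-1` C); last by [].
  by rewrite -[X in measurable X]setTI; exact: mb.
- exact: integrable_bayes.
have mbw : measurable_fun setT (fun w : R * R => bayes_estimator pi s w.2).
  exact: (measurableT_comp mb).
rewrite (integral_obs_preimage (fun w => bayes_estimator pi s w.2) C mC mbw integrable_bayes).
rewrite (integral_obs_preimage fst C mC measurable_fst integrable_signal).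
apply: eq_integral => y _ /=.
transitivity (\int[pi]_b ((bayes_estimator pi s y * \1_C y) * (b ^+ 0 * p b y))%:E)%E.
  by apply: eq_integral => b _; rewrite expr0 mul1r.
rewrite integral_moment// mulrAC bayes_estimatorE// mulrC -integral_moment//.
by apply: eq_integral => b _; congr EFin; rewrite expr1; ring.
Qed.

Lemma expect_sqr_cond_expectation :
  expect P (fun w => (cond_expectation P (fun w : R * R => w.1) obs w - w.1) ^+ 2) =
  fine (bayes_risk pi s).
Proof.
have mb := measurable_bayes_estimator pi s s_gt0 pi2.
have mo := measurable_obs s.
have bE := is_cond_expectation_bayes.
have cE : is_cond_expectation P (fun w : R * R => w.1) obs
    (cond_expectation P (fun w : R * R => w.1) obs).
  (* The default value of [xget] would require that no version exists, which [bE] refutes. *)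
  by rewrite /cond_expectation; case: xgetP => [g -> //|/(_ _ bE)].
have [mc _ _] := cE.
have mc' := measurable_g_sigma_algebra_preimage obs mo _ mc.
have [N [mN PN sN]] := cond_expectation_unique P _ obs mo _ _ cE bE.
rewrite /expect unlock; congr fine.
rewrite /bayes_risk -(integral_sqr_error pi s s_gt0 _ mb).
apply: ae_eq_integral => //.
- apply/measurable_EFinP; apply: measurable_funX.
  by apply: measurable_funB.
- apply/measurable_EFinP; apply: measurable_funX.
  by apply: measurable_funB => //; exact: (measurableT_comp mb).
exists N; split => // w /= nw; apply: sN => /= h; apply: nw => wT.
by have /= [->] := h wT.
Qed.

End posterior_mean.

(** * Additional Gaussian noise does not lower the Bayes risk *)

Section degradation.
Context {R : realType}.
Variables (pi : probability (measurableTypeR R) R) (s d : R).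
Hypothesis s_gt0 : 0 < s.
Hypothesis d_gt0 : 0 < d.
Hypothesis pi2 : (\int[pi]_b (b ^+ 2)%:E < +oo)%E.
Local Notation leb := (@lebesgue_measure R).
Local Notation r := (Num.sqrt (s ^+ 2 + d ^+ 2)).

Let r_gt0 : 0 < r.
Proof. by rewrite sqrtr_gt0 addr_gt0// exprn_gt0. Qed.

(** The noise of level [r] splits into independent parts of levels [s] and [d]; [x] is the
    intermediate observation, and Tonelli exchanges it with the signal. *)
Lemma posterior_risk_convolution (c y : R) :
  posterior_risk pi r c y =
  (\int[leb]_x ((normal_pdf x d y)%:E * posterior_risk pi s c x))%E.
Proof.
pose f (w : R * R) : R :=
  (c - w.1) ^+ 2 * (normal_pdf w.1 s w.2 * normal_pdf w.2 d y).
have mq : measurable_fun setT (fun x : R => normal_pdf x d y).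
  exact: (measurableT_comp (measurable_normal_pdf2 d d_gt0) (pair2_measurable y)).
have mf : measurable_fun setT (EFin \o f).
  apply/measurable_EFinP; apply: measurable_funM.
    by apply: measurable_funX; exact: measurable_funB.
  apply: measurable_funM; first exact: measurable_normal_pdf2.
  exact: (measurableT_comp mq).
have f0 w : (0 <= (EFin \o f) w)%E.
  by rewrite /= lee_fin mulr_ge0 ?sqr_ge0// mulr_ge0 ?normal_pdf_ge0.
have mp b : measurable_fun setT (fun x : R => (normal_pdf b s x * normal_pdf x d y)%:E).
  by apply/measurable_EFinP; apply: measurable_funM => //; exact: measurable_normal_pdf.
transitivity (\int[pi]_b \int[leb]_x (EFin \o f) (b, x))%E.
  apply: eq_integral => b _; rewrite EFinM -(normal_pdf_convolution b s d y s_gt0 d_gt0).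
  rewrite -(ge0_integralZl leb measurableT (mp b)).
  - by apply: eq_integral => x _; rewrite -EFinM.
  - by move=> x _; rewrite lee_fin mulr_ge0 ?normal_pdf_ge0.
  - by rewrite lee_fin sqr_ge0.
apply: (eq_trans (@fubini_tonelli _ _ _ _ R pi leb _ mf f0)).
apply: eq_integral => x _.
have mpx : measurable_fun setT (fun b : R => ((c - b) ^+ 2 * normal_pdf b s x)%:E).
  apply/measurable_EFinP; apply: measurable_funM.
    by apply: measurable_funX; exact: measurable_funB.
  exact: (measurableT_comp (measurable_normal_pdf2 s s_gt0) (pair2_measurable x)).
rewrite /posterior_risk -(ge0_integralZl pi measurableT mpx).
- by apply: eq_integral => b _; rewrite -EFinM; congr EFin; rewrite /f/=; ring.
- by move=> b _; rewrite lee_fin mulr_ge0 ?sqr_ge0 ?normal_pdf_ge0.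
- by rewrite lee_fin normal_pdf_ge0.
Qed.

(* At each [x], the optimality of the posterior mean given [B + s Z = x] bounds
   below the risk of any estimate computed from the noisier observation [y]. *)
Lemma bayes_risk_degradation : (bayes_risk pi s <= bayes_risk pi r)%E.
Proof.
have mb := measurable_bayes_estimator pi s s_gt0 pi2.
have mr := measurable_bayes_estimator pi r r_gt0 pi2.
have mrisk := measurable_posterior_risk pi s s_gt0 _ mb.
have risk0 c x : (0 <= posterior_risk pi s c x)%E by exact: posterior_risk_ge0.
(* Integrated over its second coordinate, [g] gives back the optimal risk at [x], since the density
   of the extra noise has mass 1. Exchanging the integrals then allows a comparison for each noisier
   observation [y]. *)
pose g (w : R * R) : \bar R :=
  ((normal_pdf w.1 d w.2)%:E * posterior_risk pi s (bayes_estimator pi s w.1) w.1)%E.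
have mg : measurable_fun setT g.
  apply: emeasurable_funM.
    by apply/measurable_EFinP; exact: measurable_normal_pdf2.
  exact: (measurableT_comp mrisk).
have g0 w : (0 <= g w)%E by rewrite mule_ge0 ?lee_fin ?normal_pdf_ge0.
have -> : bayes_risk pi s = (\int[leb]_x \int[leb]_y g (x, y))%E.
  apply: eq_integral => x _; rewrite -[LHS]mul1e -(integral_normal_pdf x d).
  rewrite muleC -(ge0_integralZl leb measurableT).
  - by apply: eq_integral => y _; rewrite muleC.
  - by apply/measurable_EFinP; exact: measurable_normal_pdf.
  - by move=> y _; rewrite lee_fin normal_pdf_ge0.
  - exact: risk0.
rewrite (@fubini_tonelli _ _ _ _ R leb leb _ mg g0).
have G0 (y : R) : [set: R] y -> (0 <= \int[leb]_x g (x, y))%E.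
  by move=> _; exact: integral_ge0.
have mG : measurable_fun setT (fun y : R => \int[leb]_x g (x, y))%E.
  exact: (@measurable_fun_fubini_tonelli_G _ _ _ _ R leb _ mg g0).
have mR : measurable_fun setT (fun y : R =>
    posterior_risk pi r (bayes_estimator pi r y) y).
  exact: measurable_posterior_risk.
rewrite /bayes_risk; apply: (ge0_le_integral leb measurableT G0 mG mR) => y _.
rewrite posterior_risk_convolution.
have mgy : measurable_fun setT (fun x : R => g (x, y)).
  exact: (measurableT_comp mg (pair2_measurable y)).
have mry : measurable_fun setT (fun x : R =>
    (normal_pdf x d y)%:E * posterior_risk pi s (bayes_estimator pi r y) x)%E.
  apply: emeasurable_funM.
    apply/measurable_EFinP.
    exact: (measurableT_comp (measurable_normal_pdf2 d d_gt0) (pair2_measurable y)).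
  exact: (measurable_posterior_risk pi s s_gt0 _ (measurable_cst (bayes_estimator pi r y))).
apply: (ge0_le_integral leb measurableT (fun x _ => g0 (x, y)) mgy mry) => x _.
apply: lee_wpmul2l; first by rewrite lee_fin normal_pdf_ge0.
exact: bayes_estimator_optimal.
Qed.

End degradation.

(** * The mmse as a function of the noise variance *)

Section mmse.
Context {R : realType}.
Variable pi : probability (measurableTypeR R) R.
Hypothesis pi2 : (\int[pi]_b (b ^+ 2)%:E < +oo)%E.
Implicit Types t u : R.
Local Notation v := (fine (\int[pi]_b (b ^+ 2)%:E)%E).

Lemma mmseE t : 0 < t -> mmse pi t = fine (bayes_risk pi (Num.sqrt t)).
Proof.
by move=> t0; apply: (expect_sqr_cond_expectation pi); rewrite ?sqrtr_gt0.
Qed.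

Lemma mmse_ge0 t : 0 < t -> 0 <= mmse pi t.
Proof. by move=> t0; rewrite mmseE// fine_ge0// bayes_risk_ge0. Qed.

Lemma mmse_bound t : 0 < t -> (v + t) * mmse pi t <= v * t.
Proof.
move=> t0; have st0 : 0 < Num.sqrt t by rewrite sqrtr_gt0.
have := bayes_risk_bound pi _ st0 pi2; rewrite sqr_sqrtr ?(ltW t0)// => h.
by rewrite mmseE.
Qed.

Lemma mmse_nondecreasing t u : 0 < t -> t <= u -> mmse pi t <= mmse pi u.
Proof.
move=> t0; rewrite le_eqVlt => /predU1P[<-//|tu].
have u0 : 0 < u by exact: lt_trans tu.
have st0 : 0 < Num.sqrt t by rewrite sqrtr_gt0.
have su0 : 0 < Num.sqrt u by rewrite sqrtr_gt0.
have d0 : 0 < Num.sqrt (u - t) by rewrite sqrtr_gt0 subr_gt0.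
have := bayes_risk_degradation pi _ _ st0 d0 pi2.
have -> : Num.sqrt t ^+ 2 + Num.sqrt (u - t) ^+ 2 = u.
  by rewrite !sqr_sqrtr ?subr_ge0 ?(ltW t0) ?(ltW tu)// subrKC.
rewrite (mmseE t t0) (mmseE u u0); apply: fine_le.
- exact: (bayes_risk_fin pi _ st0 pi2).
- exact: (bayes_risk_fin pi _ su0 pi2).
Qed.

End mmse.

(** Every positive fixed point belongs to [U], so the supremum, being itself a fixed point, is the
    greatest one. *)
Lemma is_greatest_fixed_point_sup (R : realType) (sigma2 : R)
    (mu pi : probability (measurableTypeR R) R) :
  0 < sigma2 -> spectral_law mu -> (\int[pi]_b (b ^+ 2)%:E < +oo)%E ->
  let U := pre_fixed_points (spectrum_map sigma2 mu) (mmse pi) in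
  has_sup U /\ is_greatest_fixed_point sigma2 mu pi (sup U).
Proof.
move=> sigma2_gt0 smu pi2 U.
have [L0 [kappa k0 Lgrowth]] := spectral_law_spectrum_map sigma2 mu sigma2_gt0 smu.
have Lnd := spectrum_map_monotone sigma2 mu sigma2_gt0 smu.
have m0 := mmse_ge0 pi pi2; have mnd := mmse_nondecreasing pi pi2.
have mv := mmse_bound pi pi2.
have v0 : 0 <= fine (\int[pi]_b (b ^+ 2)%:E)%E.
  by rewrite fine_ge0//; apply: integral_ge0 => b _; rewrite lee_fin sqr_ge0.
have hs := has_sup_pre_fixed_points _ _ _ v0 L0 Lnd m0 mv.
have [s0 sE] := sup_pre_fixed_points _ _ _ _ k0 v0 L0 Lnd Lgrowth m0 mnd mv.
split=> //; split; first by split.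
move=> t [t0 tE]; apply: ub_le_sup; first by case: hs.
by split => //; rewrite -[leLHS]tE.
Qed.

Theorem proposition3p9 (R : realType) (sigma2 : R) (sigma2_gt0 : 0 < sigma2) :
  [/\ (* (i) *)
      forall mu : probability (measurableTypeR R) R, spectral_law mu ->
        forall omega1 omega2 : R, 0 <= omega1 -> omega1 <= omega2 ->
          spectrum_map sigma2 mu omega1 <= spectrum_map sigma2 mu omega2,
      (* (ii) *)
      forall mu1 mu2 : probability (measurableTypeR R) R, spectral_law mu1 -> spectral_law mu2 ->
        (stieltjes_ge mu2 mu1 <->
         forall omega : R, 0 < omega ->
           spectrum_map sigma2 mu1 omega <= spectrum_map sigma2 mu2 omega),
      (* (iii) *)
      forall mu1 mu2 : probability (measurableTypeR R) R, spectral_law mu1 -> spectral_law mu2 ->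
        convex_ge mu2 mu1 ->
        forall omega : R, 0 < omega ->
          spectrum_map sigma2 mu1 omega <= spectrum_map sigma2 mu2 omega
    & (* (iv) *)
      forall pi : probability (measurableTypeR R) R,
        ('E_pi[fun b : R => (b ^+ 2)%R] < +oo)%E ->
      forall mu1 mu2 : probability (measurableTypeR R) R, spectral_law mu1 -> spectral_law mu2 ->
      forall tau1 tau2 : nat -> R,
        bayes_vamp_run sigma2 mu1 pi tau1 ->
        bayes_vamp_run sigma2 mu2 pi tau2 ->
        stieltjes_ge mu2 mu1 ->
        exists tauB1 tauB2 : R,
          [/\ is_greatest_fixed_point sigma2 mu1 pi tauB1,
              is_greatest_fixed_point sigma2 mu2 pi tauB2,
              tauB1 <= tauB2 &
              mmse pi tauB1 <= mmse pi tauB2]].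
Proof.
split.
- by move=> mu; exact: spectrum_map_monotone.
- by move=> mu1 mu2; exact: stieltjes_ge_spectrum_map.
- move=> mu1 mu2 smu1 smu2 cx; apply/stieltjes_ge_spectrum_map => //.
  exact: convex_ge_stieltjes_ge.
move=> pi pi2 mu1 mu2 smu1 smu2 _ _ _ _ G.
have {}pi2 : (\int[pi]_b (b ^+ 2)%:E < +oo)%E by move: pi2; rewrite unlock.
have [[U1 _] fix1] := is_greatest_fixed_point_sup _ sigma2 mu1 pi sigma2_gt0 smu1 pi2.
have [[_ U2] fix2] := is_greatest_fixed_point_sup _ sigma2 mu2 pi sigma2_gt0 smu2 pi2.
set t1 := sup _ in fix1; set t2 := sup _ in fix2.
(* Each pre-fixed point for [mu1] is one for [mu2]: the two spectrum maps are compared at the same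
   extrinsic variance, which is nonnegative. *)
have t12 : t1 <= t2.
  apply: sup_le_ub => // t [t0 tL]; apply: ub_le_sup => //; split => //.
  apply: (le_trans tL); apply: spectrum_map_le_of_stieltjes_ge => //.
  have v0 : 0 <= fine (\int[pi]_b (b ^+ 2)%:E)%E.
    by rewrite fine_ge0//; apply: integral_ge0 => b _; rewrite lee_fin sqr_ge0.
  by have /andP[] := extrinsic_itv _ _ _ t0 (mmse_ge0 pi pi2 t t0) v0 (mmse_bound pi pi2 t t0).
have t10 : 0 < t1 by case: fix1 => -[].
exists t1, t2; split; [exact: fix1|exact: fix2|exact: t12|].
exact: (mmse_nondecreasing pi pi2 t1 t2 t10 t12).
Qed.
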